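(* Let $X$ be a proper locally quasi-cubical (LQC) space, let $F\subset X$ be nonempty and finite, and let $Y$ be a finite set of median rays in $X$. Then $\mathrm{hull}_X(F\cup Y)$ (the median hull of the union of $F$ and the rays in $Y$) admits a $\lambda$-median $(\lambda,\lambda)$-quasi-isometry to a CAT(0) cube complex $Q$ of uniformly finite dimension (bounded only in terms of $X$), with $\lambda=\lambda(X,|F|,|Y|)>0$.
   Context: A metric space $(X,d)$ is a coarse median space if there are $m=m_X:X^3\to X$ and $\mathsf h:\mathbb N\to\mathbb N$ such that (i) $d(m(x,y,z),m(x',y',z'))\le \mathsf h(1)(d(x,x')+d(y,y')+d(z,z'))$ for all points; (ii) for each $n$ and each $A\subseteq X$ with $|A|\le n$ there are a finite CAT(0) cube complex $Q$ and maps $f:Q\to X$, $g:A\to Q$ with $d(f(m_Q(a,b,c)),m_X(f(a),f(b),f(c)))\le \mathsf h(n)$ for all $a,b,c\in Q$ and $d(a,f(g(a)))\le \mathsf h(n)$ for all $a\in A$. It has rank $v$ if these $Q$ can always be chosen of dimension at most $v$. In a CAT(0) cube complex the median of three vertices is the unique vertex lying on combinatorial geodesics between each pair of them. Median interval: $[x,y]=\{m(x,y,z):z\in X\}$. Join: $J(A)=\bigcup_{x,y\in A}[x,y]$, $J^0(A)=A$, $J^n(A)=J(J^{n-1}(A))$. In rank $v$, the median hull is $\mathrm{hull}_X(A)=J^v(A)$. A map $f$ between coarse median spaces is $\lambda$-median if $d(f(m(x,y,z)),m(f(x),f(y),f(z)))\le\lambda$ for all $x,y,z$. $X$ is locally quasi-cubical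 (LQC) if it is a coarse median space and there is a positive integer $v$ (the dimension) such that for each finite $F\subseteq X$ there are $K=K(|F|)$, a CAT(0) cube complex $Q$ of dimension $v$, and a $K$-median $(K,K)$-quasi-isometry $Q\to\mathrm{hull}_X(F)$. A $\lambda_0$-median ray is a $(\lambda_0,\lambda_0)$-quasi-isometric embedding $h:[0,\infty)\to X$ that is $\lambda_0$-median. A median ray is a $\lambda_0$-median ray for a fixed constant $\lambda_0=\lambda_0(X)$ depending only on $X$. *)

(* Defs.v *)
From HB Require Import structures.
From mathcomp Require Import all_boot all_order all_algebra.
From mathcomp Require Import all_classical all_reals all_analysis.

Set Implicit Arguments.
Unset Strict Implicit.
Unset Printing Implicit Defensive.

Import Order.TTheory GRing.Theory Num.Theory.
Local Open Scope classical_set_scope.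
Local Open Scope card_scope.
Local Open Scope ring_scope.

(* A face of {0,1}^n is given by fixing some of the coordinates. *)
Definition cube_face n (p : {ffun 'I_n -> option bool}) :
    set {ffun 'I_n -> bool} :=
  [set u | forall i b, p i = Some b -> u i = b].

Definition cube_chart (V : Type) (cubes : set (set V)) n
    (phi : {ffun 'I_n -> bool} -> V) (C : set V) : Prop :=
  [/\ injective phi, range phi = C &
      forall D, D `<=` C -> cubes D <-> exists p, D = phi @` cube_face p].

(* Cubical complexes in the sense of Bridson-Haefliger (I.7.32): cubes embed,
   and two cubes that meet do so in a single common face.  Such a complex is
   determined by the vertex sets of its cubes, and this is how it is encoded.
   Every CAT(0) cube complex is of this kind. *)
Record cube_complex := CubeComplex {
  vert :> choiceType;
  cubes : set (set vert);
  cubes_vertex : forall x, cubes [set x];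
  cubes_chart : forall C, cubes C ->
    exists n (phi : {ffun 'I_n -> bool} -> vert), cube_chart cubes phi C;
  cubes_inter : forall C D, cubes C -> cubes D ->
    C `&` D !=set0 -> cubes (C `&` D)
}.

Definition is_ncube (Q : cube_complex) n (C : set Q) : Prop :=
  cubes C /\ exists phi : {ffun 'I_n -> bool} -> Q, cube_chart (@cubes Q) phi C.

Definition dim_le (Q : cube_complex) (v : nat) : Prop :=
  forall n (C : set Q), is_ncube n C -> (n <= v)%N.

Definition has_dim (Q : cube_complex) (v : nat) : Prop :=
  dim_le Q v /\ exists C : set Q, is_ncube v C.

Definition finite_complex (Q : cube_complex) : Prop := finite_set [set: Q].

Definition adj (Q : cube_complex) : rel Q :=
  fun x y => `[< x <> y /\ cubes [set x; y] >].

Definition square (Q : cube_complex) (x y z w : Q) : Prop :=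
  [/\ cubes [set t | t \in [:: x; y; z; w]],
      uniq [:: x; y; z; w] & cycle (@adj Q) [:: x; y; z; w]].

(* Edge paths are the sequences of their vertices.  The relation below is
   equality in the edge-path groupoid of the 2-skeleton, i.e. homotopy relative
   to the endpoints. *)
Inductive homotopic (Q : cube_complex) : seq Q -> seq Q -> Prop :=
| homotopic_refl s : homotopic s s
| homotopic_sym s t : homotopic s t -> homotopic t s
| homotopic_trans s t u : homotopic s t -> homotopic t u -> homotopic s u
| homotopic_backtrack s t x y : adj x y ->
    homotopic (s ++ [:: x; y; x] ++ t) (s ++ [:: x] ++ t)
| homotopic_square s t x y z w : square x y z w ->
    homotopic (s ++ [:: x; y; z] ++ t) (s ++ [:: x; w; z] ++ t).

Definition connected_complex (Q : cube_complex) : Prop :=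
  forall x y : Q, exists s, path (@adj Q) x s /\ last x s = y.

Definition simply_connected (Q : cube_complex) : Prop :=
  connected_complex Q /\
  forall (x : Q) s, path (@adj Q) x s -> last x s = x ->
    homotopic (x :: s) [:: x].

(* The link of x, as an abstract simplicial complex on the neighbours of x: one
   simplex for each cube containing x. *)
Definition link_simplex (Q : cube_complex) (x : Q) (S : set Q) : Prop :=
  exists C, [/\ cubes C, C x & S = [set y | C y /\ adj x y]].

Definition flag_links (Q : cube_complex) : Prop :=
  forall (x : Q) (S : set Q), finite_set S -> (forall y, S y -> adj x y) ->
    (forall y z, S y -> S z -> link_simplex x [set y; z]) -> link_simplex x S.

Definition CAT0 (Q : cube_complex) : Prop := simply_connected Q /\ flag_links Q.

Definition path_of_length (Q : cube_complex) (x y : Q) : set nat :=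
  [set n | exists s, [/\ path (@adj Q) x s, last x s = y & size s = n]].

(* The least length of an edge path; 0 if there is none (never the case in a
   connected complex). *)
Definition cdist (Q : cube_complex) (x y : Q) : nat :=
  xget 0%N [set n | path_of_length x y n /\
                    forall k, path_of_length x y k -> (n <= k)%N].

Definition on_geodesic (Q : cube_complex) (x y p : Q) : Prop :=
  exists s, [/\ path (@adj Q) x s, last x s = y, size s = cdist x y
              & p \in x :: s].

(* In a CAT(0) cube complex the defining set is a singleton, and the default
   value x is irrelevant. *)
Definition cmed (Q : cube_complex) (x y z : Q) : Q :=
  xget x [set p | [/\ on_geodesic x y p, on_geodesic y z p & on_geodesic x z p]].

Definition vdist (R : realType) (Q : cube_complex) (x y : Q) : R :=
  (cdist x y)%:R.

Definition qi_embedding (R : realType) (A B : Type)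
    (dA : A -> A -> R) (dB : B -> B -> R) (l : R) (f : A -> B) : Prop :=
  forall x y, l^-1 * dA x y - l <= dB (f x) (f y) <= l * dA x y + l.

Definition quasi_isometry (R : realType) (A B : Type)
    (dA : A -> A -> R) (dB : B -> B -> R) (l : R) (f : A -> B) : Prop :=
  qi_embedding dA dB l f /\ forall b, exists a, dB (f a) b <= l.

Definition median_map (R : realType) (A B : Type) (mA : A -> A -> A -> A)
    (dB : B -> B -> R) (mB : B -> B -> B -> B) (l : R) (f : A -> B) : Prop :=
  forall x y z, dB (f (mA x y z)) (mB (f x) (f y) (f z)) <= l.

Definition proper_space (R : realType) (X : metricType R) : Prop :=
  forall (x : X) (r : R), compact [set y | mdist x y <= r].

Definition coarse_median_of_rank (R : realType) (X : metricType R)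
    (m : X -> X -> X -> X) (r : nat) : Prop :=
  exists h : nat -> nat,
    (forall x y z x' y' z', mdist (m x y z) (m x' y' z') <=
       (h 1%N)%:R * (mdist x x' + mdist y y' + mdist z z')) /\
    (forall (n : nat) (A : set X), A #<= `I_n ->
       exists Q : cube_complex, [/\ CAT0 Q, finite_complex Q, dim_le Q r &
         exists (f : Q -> X) (g : A -> Q),
           median_map (@cmed Q) (@mdist R X) m (h n)%:R f /\
           forall a : A, mdist (val a) (f (g a)) <= (h n)%:R]).

Definition median_interval (X : Type) (m : X -> X -> X -> X) (x y : X) : set X :=
  range (m x y).

Definition median_join (X : Type) (m : X -> X -> X -> X) (A : set X) : set X :=
  \bigcup_(x in A) \bigcup_(y in A) median_interval m x y.

(* r is meant to be the rank of the coarse median m. *)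
Definition median_hull (X : Type) (m : X -> X -> X -> X) (r : nat) (A : set X) : set X :=
  iter r (median_join m) A.

Definition sub_dist (R : realType) (X : metricType R) (A : set X) (x y : A) : R :=
  mdist (val x) (val y).

(* A median hull is closed under m only up to bounded error; so the median on it
   is the one of X, moved into the hull by at most l. *)
Definition induced_median (R : realType) (X : metricType R)
    (m : X -> X -> X -> X) (A : set X) (l : R) (mu : A -> A -> A -> A) : Prop :=
  forall x y z : A, mdist (val (mu x y z)) (m (val x) (val y) (val z)) <= l.

(* F is nonempty because the hull of the empty set is empty and a complex of
   positive dimension is not. *)
Definition LQC (R : realType) (X : metricType R) (m : X -> X -> X -> X)
    (r : nat) : Prop :=
  coarse_median_of_rank m r /\
  exists (v : nat) (K : nat -> R), [/\ (0 < v)%N, forall n, 0 < K n &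
    forall (n : nat) (F : set X), F !=set0 -> F #= `I_n ->
      exists Q : cube_complex, [/\ CAT0 Q, has_dim Q v &
        exists f : Q -> median_hull m r F,
          quasi_isometry (@vdist R Q) (@sub_dist R X (median_hull m r F)) (K n) f /\
          median_map (@cmed Q) (@mdist R X) m (K n) (fun q => val (f q))]].

Definition med3 (d : Order.disp_t) (T : orderType d) (x y z : T) : T :=
  Order.max (Order.min x y) (Order.min (Order.max x y) z).

Definition ray_dist (R : realType) (s t : {nonneg R}) : R :=
  `|s%:num - t%:num|.

Definition median_ray (R : realType) (X : metricType R) (m : X -> X -> X -> X)
    (l : R) (h : {nonneg R} -> X) : Prop :=
  qi_embedding (@ray_dist R) (@mdist R X) l h /\
  median_map (fun s t u => med3 s t u) (@mdist R X) m l h.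

(* Main.v *)
Require Import Defs.
From mathcomp Require Import all_boot all_order all_algebra.
From mathcomp Require Import all_classical all_reals all_analysis.
From mathcomp Require Import zify lra.

Set Implicit Arguments.
Unset Strict Implicit.
Unset Printing Implicit Defensive.

Import Order.TTheory GRing.Theory Num.Theory.
Local Open Scope classical_set_scope.
Local Open Scope card_scope.
Local Open Scope ring_scope.

(** Each ray is exhausted by its initial segments, and the points of a ray up to time
    [t] lie coarsely between its points at times [0] and [t].  Hence every point of the
    hull [H] of [F] and the rays is near the hulls of the finite sets [A t], which
    consist of [F] and of the points of the rays at times [0] and [t], as soon as [t]
    is large ([hull_exhausted]).  These sets have boundedly many elements, so that local
    quasi-cubicality presents their hulls, uniformly in [t], by CAT(0) cube complexes
    [Q t] of one fixed dimension.  The complex for [H] is the ultraproduct of the [Q t],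
    based near a point of [H]: a point of [H] goes to the class of a sequence of vertices
    of the [Q t] whose images lie near it.  Properness of [X] makes this map coarsely
    onto, because the images of a bounded sequence of vertices cluster somewhere, so that
    the sequence stays near one of its own terms, which is a point of [H]
    ([bounded_ultra], [exists_limit_complex]).

    Two facts about CAT(0) cube complexes are needed, and both rest on the passage from
    the local definition (simply connected, flag links) to medians of the whole graph.

    (1) In a median hull of rank [r], joining more than [r] times adds nothing, up to
    bounded distance ([iter_join_near_hull]).  Each point of an iterated join involves a
    bounded number of points, so this may be checked in a finite CAT(0) complex of
    dimension at most [r].  There a point [c] of the convex hull of [A] is reached from
    any [a] in [A] by [r] medians with [c] and points of [A], each of which puts one more
    of the hyperplanes adjacent to [c] behind; those hyperplanes adjacent to [c] that lie
    on the way to [a] cross pairwise, so there are at most [r] of them ([hull_reached]).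

    (2) An ultraproduct of CAT(0) cube complexes of bounded dimension is one.  Everything
    but simple connectivity is a condition on finitely many vertices at a time.  Simple
    connectivity comes from the quadrangle condition, which is of this kind: with it a
    loop is contracted by pushing its farthest vertices across squares
    ([rank_contraction], [ultraproduct_CAT0]).

    From local to global.  Edge paths are treated as words, up to pushing them across
    squares ([swaps]).  Two such equivalent paths with the same end either have
    equivalent beginnings, or their last edges span a square along which they can be
    compared one step earlier ([swaps_diamond]); flagness enters here, by completing three
    squares at a vertex to a cube.  It follows that appending an edge, or cancelling it
    against the end of the path, is a well-defined operation on reduced paths that is
    compatible with homotopy, so that in a simply connected complex a reduced path is
    determined by its endpoints up to squares ([reduced_uniq]).  In particular reduced
    paths are geodesic, distances to adjacent vertices differ by one, and the quadrangle
    condition holds ([quadrangle]).  This makes half-spaces convex ([closer_convex]) and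
    medians exist and be unique ([cmedP], [cmed_uniq]). *)

(** * Cubes, squares and links *)

Section Flip.
Variable n : nat.
Implicit Types (u : {ffun 'I_n -> bool}) (i j : 'I_n).

Definition flip u i : {ffun 'I_n -> bool} := [ffun j => u j (+) (j == i)].

Lemma flipC u i j : flip (flip u i) j = flip (flip u j) i.
Proof. by apply/ffunP => k; rewrite !ffunE addbAC. Qed.

Lemma flip_neq u i : flip u i <> u.
Proof. by move=> /ffunP/(_ i); rewrite ffunE eqxx; case: (u i). Qed.

Lemma flip_inj u i j : flip u i = flip u j -> i = j.
Proof.
move=> /ffunP/(_ i); rewrite !ffunE eqxx => /addbI.
by move/esym/eqP.
Qed.

(** Neighbours in a cube have opposite parity; so opposite corners of a square are
    not adjacent. *)
Definition parity u := \big[addb/false]_i u i.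

Lemma parity_flip u i : parity (flip u i) = ~~ parity u.
Proof.
rewrite /parity -addbT (eq_bigr (fun j => u j (+) (j == i))); last first.
  by move=> j _; rewrite ffunE.
rewrite big_split /=; congr (_ (+) _).
by rewrite (bigD1 i) //= eqxx big1 // => j /negPf ->.
Qed.

End Flip.

Section LocalGeometry.
Variable Q : cube_complex.
Implicit Types (x y z w : Q) (C D : set Q).

Lemma adjP x y : reflect (x <> y /\ cubes [set x; y]) (adj x y).
Proof. exact: asboolP. Qed.

Lemma adj_sym x y : adj x y = adj y x.
Proof.
by apply/adjP/adjP => -[ne c]; split; [move=> /esym | rewrite setUC | move=> /esym | rewrite setUC].
Qed.

Lemma adj_irr x : adj x x = false.
Proof. by apply/adjP => -[]. Qed.

Section Chart.
Variables (n : nat) (phi : {ffun 'I_n -> bool} -> Q) (C : set Q).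
Hypothesis chart_phi : cube_chart (@cubes Q) phi C.

Lemma chart_mem u : C (phi u).
Proof. by have [_ <- _] := chart_phi; exists u. Qed.

Lemma chart_face p : cubes (phi @` cube_face p).
Proof.
have [_ _ facesP] := chart_phi; apply/facesP; last by exists p.
by move=> _ [u _ <-]; apply: chart_mem.
Qed.

Lemma chart_adj u i : adj (phi u) (phi (flip u i)).
Proof.
have [phi_inj _ _] := chart_phi.
apply/adjP; split; first by move=> /phi_inj/esym/flip_neq.
suff -> : [set phi u; phi (flip u i)] =
    phi @` cube_face [ffun j => if j == i then None else Some (u j)].
  exact: chart_face.
apply/seteqP; split => [x [] ->|_ [v v_face <-]].
- by exists u => // j b; rewrite ffunE; case: eqP => // _ [].
- exists (flip u i) => // j b; rewrite !ffunE; case: eqP => // _ [].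
  by rewrite addbF.
have [eq_i|neq_i] := eqVneq (v i) (u i); [left|right]; congr (phi _);
  apply/ffunP => j; have := v_face j (u j); rewrite !ffunE;
  case: eqP => [->|_ ->]; rewrite ?addbF // => _.
by move: neq_i; case: (v i); case: (u i).
Qed.

Lemma chart_adj_inv u v : adj (phi u) (phi v) -> exists i, v = flip u i.
Proof.
have [phi_inj _ facesP] := chart_phi.
move=> /adjP[uv /facesP[|p Ep]].
  by move=> _ [] ->; apply: chart_mem.
have pu : cube_face p u.
  have : [set phi u; phi v] (phi u) by left.
  by rewrite Ep => -[w pw /phi_inj <-].
have pv : cube_face p v.
  have : [set phi u; phi v] (phi v) by right.
  by rewrite Ep => -[w pw /phi_inj <-].
have [i uvi] : exists i, u i != v i.
  apply/not_existsP => eq_uv; apply: uv; congr phi; apply/ffunP => i.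
  by apply/eqP/negPn/negP/eq_uv.
exists i; have : [set phi u; phi v] (phi (flip u i)).
  rewrite Ep; exists (flip u i) => // j b pj; rewrite ffunE (pu _ _ pj).
  case: eqP => [eij|]; last by rewrite addbF.
  by move: uvi; rewrite -eij (pu _ _ pj) (pv _ _ pj) eqxx.
by case=> /phi_inj => [/flip_neq|->].
Qed.

Lemma chart_link u y : C y /\ adj (phi u) y <-> exists i, y = phi (flip u i).
Proof.
split=> [[]|[i ->]]; last by split; [exact: chart_mem | exact: chart_adj].
have [_ <- _] := chart_phi => -[v _ <-] /chart_adj_inv[i ->]; by exists i.
Qed.

Lemma chart_square u i j : i != j ->
  square (phi u) (phi (flip u i)) (phi (flip (flip u i) j)) (phi (flip u j)).
Proof.
move=> ij; have [phi_inj _ _] := chart_phi.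
have ji : (j == i) = false by rewrite eq_sym (negPf ij).
split.
- set S := [set _ | _].
  suff -> : S = phi @` cube_face
      [ffun k => if (k == i) || (k == j) then None else Some (u k)].
    exact: chart_face.
  apply/seteqP; split => [x|_ [v v_face <-]].
    rewrite /S /= !inE => /or4P[] /eqP ->; [exists u|exists (flip u i)|
      exists (flip (flip u i) j)|exists (flip u j)] => // k b;
      by rewrite !ffunE; case: eqP => //= _; case: eqP => //= _ [<-]; rewrite ?addbF.
  rewrite /S /= !inE !(inj_eq phi_inj).
  have vE k : k != i -> k != j -> v k = u k.
    by move=> ki kj; apply: v_face; rewrite ffunE (negPf ki) (negPf kj).
  have [vi|vi] := eqVneq (v i) (u i); have [vj|vj] := eqVneq (v j) (u j); apply/or4P.
  + constructor 1; apply/eqP/ffunP => k.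
    by have [->//|ki] := eqVneq k i; have [->//|kj] := eqVneq k j; apply: vE.
  + constructor 4; apply/eqP/ffunP => k; rewrite ffunE.
    have [->|kj] := eqVneq k j; first by move: vj; case: (v j); case: (u j).
    by rewrite addbF; have [->//|ki] := eqVneq k i; apply: vE.
  + constructor 2; apply/eqP/ffunP => k; rewrite ffunE.
    have [->|ki] := eqVneq k i; first by move: vi; case: (v i); case: (u i).
    by rewrite addbF; have [->//|kj] := eqVneq k j; apply: vE.
  + constructor 3; apply/eqP/ffunP => k; rewrite !ffunE.
    have [->|ki] := eqVneq k i.
      by rewrite (negPf ij) addbF; move: vi; case: (v i); case: (u i).
    have [->|kj] := eqVneq k j; first by rewrite addbF; move: vj; case: (v j); case: (u j).
    by rewrite !addbF; apply: vE.
- have neq a b : a <> b -> (phi a == phi b) = false.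
    by move=> ab; apply/negP => /eqP/phi_inj.
  have uij : u <> flip (flip u i) j.
    by move=> /ffunP/(_ i); rewrite !ffunE eqxx (negPf ij); case: (u i).
  have fij : flip u i <> flip u j by move=> /flip_inj/eqP; rewrite (negPf ij).
  rewrite /= !inE !neq //; try by move=> /esym/flip_neq.
  by rewrite flipC => /flip_neq.
- rewrite /= !chart_adj /= andbT flipC [X in X && _]adj_sym chart_adj /=.
  by rewrite adj_sym chart_adj.
Qed.

End Chart.

Lemma square_adj x y z w : square x y z w ->
  [/\ adj x y, adj y z, adj z w & adj w x].
Proof. by case=> _ _ /= /and5P[-> -> -> ->]. Qed.

Lemma square_neq x y z w : square x y z w ->
  [/\ x != y, x != z, x != w & [/\ y != z, y != w & z != w]].
Proof.
by case=> _ /=; rewrite !inE !negb_or => /and4P[/and3P[-> -> ->] /andP[-> ->] -> _].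
Qed.

Lemma square_rot x y z w : square x y z w -> square y z w x.
Proof.
case=> cub uni cyc; split.
- suff <- : [set t | t \in [:: x; y; z; w]] = [set t | t \in [:: y; z; w; x]] by [].
  by apply/seteqP; split => t /=; rewrite !inE => /or4P[] ->; rewrite ?orbT.
- by rewrite -(rot_uniq 1) in uni.
- by rewrite -(rot_cycle 1) in cyc.
Qed.

Lemma square_reflect x y z w : square x y z w -> square x w z y.
Proof.
move=> sq; have [xy yz zw wx] := square_adj sq; case: sq => cub uni cyc; split.
- suff <- : [set t | t \in [:: x; y; z; w]] = [set t | t \in [:: x; w; z; y]] by [].
  by apply/seteqP; split => t /=; rewrite !inE => /or4P[] ->; rewrite ?orbT.
- by move: uni; rewrite -rev_uniq -(rot_uniq 3).
- by rewrite /= adj_sym wx adj_sym zw adj_sym yz adj_sym xy.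
Qed.

(** The intersection of the two squares is a cube with two edges at [y]; the square
    that these edges span in it is all of both. *)
Lemma square_uniq x y z w w' : square x y z w -> square x y z w' -> w = w'.
Proof.
move=> sq sq'; have [xy yz _ _] := square_adj sq.
have [_ xz _ _] := square_neq sq.
case: sq sq' => cC _ _ [cD _ _].
set C := [set t | t \in [:: x; y; z; w]] in cC.
set D := [set t | t \in [:: x; y; z; w']] in cD.
have mE t : t \in [:: x; y; z] -> (C `&` D) t.
  by rewrite !inE /C /D => h; split; rewrite /= !inE; move: h => /or3P[] ->; rewrite ?orbT.
have cE : cubes (C `&` D).
  by apply: cubes_inter => //; exists x; apply: mE; rewrite !inE eqxx.
have [n [phi ch]] := cubes_chart cE.
have [phi_inj rphi _] := ch.
have [v _ yE] : range phi y by rewrite rphi; apply: mE; rewrite !inE eqxx ?orbT.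
have [i xE] : exists i, x = phi (flip v i).
  apply/(chart_link ch); split; first by apply: mE; rewrite !inE eqxx.
  by rewrite yE adj_sym.
have [j zE] : exists i, z = phi (flip v i).
  apply/(chart_link ch); split; first by apply: mE; rewrite !inE eqxx ?orbT.
  by rewrite yE.
have ij : i != j by apply: contra_neq xz => e; rewrite xE zE e.
have /square_neq[yx' yt _ [xt _ tz]] := chart_square ch v ij.
have [Ct Dt] := chart_mem ch (flip (flip v i) j).
move: tz xt yt; rewrite -xE -zE yE => tz xt yt.
(* the fourth corner of the common square lies in both squares *)
have tw : phi (flip (flip v i) j) = w.
  move: Ct; rewrite /C /= !inE (negPf tz) [_ == x]eq_sym (negPf xt).
  by rewrite [_ == y]eq_sym (negPf yt) /= => /eqP.
have tw' : phi (flip (flip v i) j) = w'.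
  move: Dt; rewrite /D /= !inE (negPf tz) [_ == x]eq_sym (negPf xt).
  by rewrite [_ == y]eq_sym (negPf yt) /= => /eqP.
by rewrite -tw tw'.
Qed.

Lemma square_link x y w z : square x y w z -> link_simplex x [set y; z].
Proof.
move=> sq; have [xy yw wz zx] := square_adj sq; case: sq => cC _ _.
set C := [set t | t \in [:: x; y; w; z]] in cC.
exists C; split=> //; first by rewrite /C /= !inE eqxx.
have [n [phi ch]] := cubes_chart cC; have [phi_inj rphi _] := ch.
apply/seteqP; split=> [t [] ->|t []].
- by split=> //; rewrite /C /= !inE eqxx /= !orbT.
- by split; rewrite 1?adj_sym // /C /= !inE eqxx /= !orbT.
move=> /[swap] xt; rewrite /C /= !inE => /or4P[] /eqP tE; move: xt; rewrite tE;
  [by rewrite adj_irr | by left | move=> xw | by right].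
have [v _ xE] : range phi x by rewrite rphi /C /= !inE eqxx.
have [v' _ wE] : range phi w by rewrite rphi /C /= !inE eqxx ?orbT.
have [v'' _ yE] : range phi y by rewrite rphi /C /= !inE eqxx ?orbT.
exfalso; move: xy yw xw; rewrite -xE -wE -yE => /(chart_adj_inv ch)[i ->].
move=> /(chart_adj_inv ch)[j ->] /(chart_adj_inv ch)[k].
by move=> /(congr1 (@parity n)); rewrite !parity_flip; case: (parity v).
Qed.

Lemma edge_link x y : adj x y -> link_simplex x [set y; y].
Proof.
move=> xy; have /adjP[_ cxy] := xy.
exists [set x; y]; split => //; first by left.
rewrite setUid; apply/seteqP; split=> [_ ->|t [[] ->]] //; first by split=> //; right.
by rewrite adj_irr.
Qed.

(** Three squares filling the corners of a vertex pairwise are three faces of a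
    cube, by flagness; [v] is then the vertex where the other three meet. *)
Lemma three_squares x a b c p q s : flag_links Q ->
  square x a p b -> square x a q c -> square x b s c ->
  exists v, [/\ square a p v q, square b p v s & square c q v s].
Proof.
move=> flagQ s1 s2 s3.
have [xa _ _ bx] := square_adj s1; have [_ _ _ cx] := square_adj s2.
have xb : adj x b by rewrite adj_sym. have xc : adj x c by rewrite adj_sym.
have [_ _ _ [_ ab _]] := square_neq s1; have [_ _ _ [_ ac _]] := square_neq s2.
have [_ _ _ [_ bc _]] := square_neq s3.
have [|t|t t'|C [cC Cx E]] := flagQ x [set t | t \in [:: a; b; c]].
- exact: finite_seq.
- rewrite /= => t_abc; move: t_abc; rewrite 3!in_cons in_nil orbF.
  by case/or3P => /eqP ->.
- rewrite /= !inE => /or3P[] /eqP -> /or3P[] /eqP ->; try exact: edge_link;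
  try exact: (square_link s1); try exact: (square_link s2);
  try exact: (square_link s3); rewrite setUC;
  [exact: (square_link s1)|exact: (square_link s2)|exact: (square_link s3)].
have [n [phi ch]] := cubes_chart cC; have [phi_inj rphi _] := ch.
have [u _ xE] : range phi x by rewrite rphi.
have nb t : t \in [:: a; b; c] -> exists i, t = phi (flip u i).
  move=> ht; apply/(chart_link ch); rewrite xE.
  by have : [set t | t \in [:: a; b; c]] t by []; rewrite E.
have [i aE] : exists i, a = phi (flip u i) by apply: nb; rewrite !inE eqxx.
have [j bE] : exists i, b = phi (flip u i) by apply: nb; rewrite !inE eqxx ?orbT.
have [k cE] : exists i, c = phi (flip u i) by apply: nb; rewrite !inE eqxx ?orbT.
have ij : i != j by apply: contra_neq ab => e; rewrite aE bE e.
have ik : i != k by apply: contra_neq ac => e; rewrite aE cE e.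
have jk : j != k by apply: contra_neq bc => e; rewrite bE cE e.
have corner l m d e f : l != m -> d = phi (flip u l) -> e = phi (flip u m) ->
    square x d f e -> f = phi (flip (flip u l) m).
  move=> lm -> -> sq; have := chart_square ch u lm; rewrite xE => sq'.
  by have := square_uniq (square_rot (square_rot (square_rot sq)))
     (square_rot (square_rot (square_rot sq'))).
have pE := corner _ _ _ _ _ ij aE bE s1.
have qE := corner _ _ _ _ _ ik aE cE s2.
have sE := corner _ _ _ _ _ jk bE cE s3.
exists (phi (flip (flip (flip u i) j) k)); rewrite aE bE cE pE qE sE; split.
- exact: (chart_square ch).
- rewrite (flipC u i j); exact: (chart_square ch).
- rewrite (flipC (flip u i) j k) (flipC u i k) (flipC u j k).
  exact: (chart_square ch).
Qed.

End LocalGeometry.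

(** * Edge paths up to squares *)

Section EdgePathWords.
Variable Q : cube_complex.
Implicit Types (x y z w : Q) (p q s u : seq Q).

(** Paths are written backwards here, endpoint first, so that appending an edge
    is [cons]. *)
Inductive swap : seq Q -> seq Q -> Prop :=
| swap_here x y w y' u : square x y w y' -> swap [:: x, y, w & u] [:: x, y', w & u]
| swap_cons x p q : swap p q -> swap (x :: p) (x :: q).

Inductive swaps : seq Q -> seq Q -> Prop :=
| swaps_refl p : swaps p p
| swaps_step p q s : swap p q -> swaps q s -> swaps p s.

Inductive backtracks : seq Q -> Prop :=
| backtracks_here x y s : backtracks [:: x, y, x & s]
| backtracks_cons x p : backtracks p -> backtracks (x :: p).

Definition reduced p := forall q, swaps p q -> ~ backtracks q.

Lemma swap_sym p q : swap p q -> swap q p.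
Proof.
elim=> [x y w y' s /square_reflect|x p' q' _]; [exact: swap_here | exact: swap_cons].
Qed.

Lemma swaps_trans p q s : swaps p q -> swaps q s -> swaps p s.
Proof. by elim=> // a b c ab _ IH /IH; exact: swaps_step. Qed.

Lemma swaps1 p q : swap p q -> swaps p q.
Proof. by move=> h; apply: swaps_step h (swaps_refl q). Qed.

Lemma swaps_sym p q : swaps p q -> swaps q p.
Proof.
elim=> [a|a b c /swap_sym/swaps1 ba _ cb]; first exact: swaps_refl.
exact: swaps_trans cb ba.
Qed.

Lemma swaps_cons x p q : swaps p q -> swaps (x :: p) (x :: q).
Proof.
elim=> [a|a b c ab _]; first exact: swaps_refl.
by apply: swaps_step; apply: swap_cons.
Qed.

Lemma swaps_square x y w y' u : square x y w y' ->
  swaps [:: x, y, w & u] [:: x, y', w & u].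
Proof. by move=> sq; apply/swaps1/swap_here. Qed.

Lemma swap_head x p q : swap (x :: p) q -> exists q', q = x :: q'.
Proof.
move=> h; inversion h as [? ? w y' u|? ? q']; first by exists [:: y', w & u].
by exists q'.
Qed.

Lemma swaps_head x p q : swaps (x :: p) q -> exists q', q = x :: q'.
Proof.
move eq_p' : (x :: p) => p' h; elim: h p eq_p' => [? ? <-|a b c ab _ IH r e].
  by eexists.
by move: ab; rewrite -e => /swap_head[b' /esym/IH].
Qed.

Lemma swaps_headE x y p q : swaps (x :: p) (y :: q) -> x = y.
Proof. by move=> /swaps_head[? []]. Qed.

Lemma swaps_size p q : swaps p q -> size p = size q.
Proof.
elim=> // a b c ab _ <-; elim: ab => //= x a' b' _ ->//.
Qed.

Lemma swaps_last x0 p q : swaps p q -> last x0 p = last x0 q.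
Proof.
elim=> // a b c ab _ <-; elim: ab x0 => //= x a' b' _ IH x0; exact: IH.
Qed.

Lemma swap_sorted p q : swap p q -> sorted (@adj Q) p -> sorted (@adj Q) q.
Proof.
elim=> [x y w y' u sq|x [|y p'] q' h IH].
- have [xy yw wy' y'x] := square_adj sq.
  by rewrite /= => /and3P[_ _ ->]; rewrite (adj_sym x) y'x (adj_sym y') wy'.
- by inversion h.
- by have [r ?] := swap_head h; subst q' => /= /andP[-> /IH].
Qed.

Lemma swaps_sorted p q : swaps p q -> sorted (@adj Q) p -> sorted (@adj Q) q.
Proof. by elim=> // a b c ab _ IH /(swap_sorted ab)/IH. Qed.

Lemma reduced_swaps p q : swaps p q -> reduced p -> reduced q.
Proof. by move=> pq rp s qs; apply/rp/(swaps_trans pq). Qed.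

Lemma reduced_tail x p : reduced (x :: p) -> reduced p.
Proof.
by move=> rp q pq bq; apply: (rp (x :: q)); [exact: swaps_cons | exact: backtracks_cons].
Qed.

Lemma not_reduced p : ~ reduced p -> exists2 q, swaps p q & backtracks q.
Proof. by move=> /existsNP[q /not_implyP[pq /contrapT bq]]; exists q. Qed.

Hypothesis flagQ : flag_links Q.

(** [p] and [p'] are the tails of two paths ending at [x]: either they agree up
    to squares, or the two last edges span a square. *)
Definition diamond x p p' := swaps p p' \/
  exists y y' w u, [/\ square x y w y', swaps p [:: y, w & u] & swaps p' [:: y', w & u]].

(** Along a sequence of swaps the last edges pass through a gallery of squares
    around [x]; a gallery of two squares is shortened to one by completing the
    cube spanned by them and by the square found one step earlier. *)
Lemma swaps_diamond x p p' : swaps (x :: p) (x :: p') -> diamond x p p'.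
Proof.
have [n] := ubnP (size p); elim: n => // n IHn in x p p' * => size_p.
move eqa : (x :: p) => a; move eqb : (x :: p') => b ab.
elim: ab p eqa eqb size_p => {a b} [a p <- [->] _|a b c ab _ IH p pa pc size_p].
  by left; exact: swaps_refl.
subst a c; have [q eq_b] := swap_head ab; subst b.
have size_q : (size q < n.+1)%N.
  by have /swaps_size/= [<-] := swaps1 ab.
have Dq := IH _ (erefl _) (erefl _) size_q.
inversion ab as [? y0 w01 y1 u01 sq01|? ? ? pq]; subst; last first.
  case: Dq => [qp'|[y [y' [w [u [sq qy p'y']]]]]].
    by left; apply: swaps_step qp'.
  by right; exists y, y', w, u; split=> //; apply: swaps_step qy.
case: Dq => [qp'|[y [y2 [w12 [u12 [sq12 qy p'y2]]]]]].
  by right; exists y0, y1, w01, u01; split=> //; [exact: swaps_refl|exact: swaps_sym].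
have ? := swaps_headE qy; subst y.
have D1 : diamond y1 (w01 :: u01) (w12 :: u12) by apply: IHn.
(* the two squares around [x] coincide if they have the same far corner *)
have [eq_w|neq_w] := eqVneq w01 w12.
  subst w12.
  have ? : y0 = y2.
    exact: square_uniq (square_reflect sq01) sq12.
  subst y2; left.
  case: D1 => [w_w|[y [y' [w [u [sq wu wu']]]]]].
    by apply: swaps_trans (swaps_sym p'y2); apply: swaps_cons.
  have ? := swaps_headE wu; have ? := swaps_headE wu'; subst y y'.
  by have [_ _ _ [_ ]] := square_neq sq; rewrite eqxx.
case: D1 => [/swaps_headE e|[y [y' [v [u [sq wu wu']]]]]].
  by move: neq_w; rewrite e eqxx.
(* the squares at [y1] spanned by [x], [w01] and [w12] are faces of a cube *)
have ? := swaps_headE wu; have ? := swaps_headE wu'; subst y y'.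
have [z [sx s1 s2]] := three_squares flagQ (square_rot (square_rot (square_rot sq01)))
  (square_reflect (square_rot sq12)) sq.
right; exists y0, y2, z, (v :: u); split=> //.
- apply: swaps_trans (swaps_cons y0 wu) _.
  exact: swaps_square (square_rot (square_rot (square_rot (square_reflect s1)))).
- apply: swaps_trans p'y2 _; apply: swaps_trans (swaps_cons y2 wu') _.
  exact: swaps_square (square_rot (square_rot (square_rot (square_reflect s2)))).
Qed.

Lemma swaps_corner x y y' p p' : swaps [:: x, y & p] [:: x, y' & p'] -> y != y' ->
  exists w u, [/\ square x y w y', swaps (y :: p) [:: y, w & u]
    & swaps (y' :: p') [:: y', w & u]].
Proof.
case/swaps_diamond => [/swaps_headE ->|[z [z' [w [u [sq h h']]]]]]; first by rewrite eqxx.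
have ? := swaps_headE h; have ? := swaps_headE h'; subst z z'.
by move=> _; exists w, u.
Qed.

Lemma swaps_cancel x y p p' :
  swaps [:: x, y & p] [:: x, y & p'] -> swaps (y :: p) (y :: p').
Proof.
case/swaps_diamond => [//|[z [z' [w [u [sq h h']]]]]].
have ? := swaps_headE h; have ? := swaps_headE h'; subst z z'.
by have [_ _ _ [_]] := square_neq sq; rewrite eqxx.
Qed.

(** If appending [y] creates a backtrack somewhere, then it cancels against the last
    edge: by [swaps_corner] the backtrack can be moved to the front, one square at a
    time. *)
Lemma reduced_extension x y p : reduced (x :: p) -> ~ reduced [:: y, x & p] ->
  exists s, swaps (x :: p) [:: x, y & s].
Proof.
have [n] := ubnP (size p); elim: n => // n IHn in x y p * => size_p red_p.
case/not_reduced => q yq; have [q1 ?] := swaps_head yq; subst q.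
case: q1 yq => [/swaps_size//|x' q yq bq].
have [?|xx'] := eqVneq x x'.
  subst x'; have pq := swaps_cancel yq.
  inversion bq as [? ? s|? ? bq1]; subst; first by exists s.
  by case: (red_p _ pq bq1).
have [w [u [sq pu qu]]] := swaps_corner yq xx'.
have red_wu : reduced (w :: u) by apply: reduced_tail (reduced_swaps pu red_p).
inversion bq as [? ? s|? ? bq1]; subst; last first.
  have [||s ws] := IHn w x' u _ red_wu.
  - by have /= [] := swaps_size pu; move: size_p => /[swap] ->; rewrite ltnS; lia.
  - by move=> /(_ _ (swaps_sym qu)).
  exists (x' :: s); apply: swaps_trans pu _; apply: swaps_trans (swaps_cons x ws) _.
  exact: swaps_square (square_rot sq).
have [_ yw _ _] := square_neq sq.
have [z [u2 [sq2 yu wu]]] := swaps_corner qu yw.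
have ? : z = x.
  exact: square_uniq (square_rot (square_rot (square_rot (square_reflect sq2))))
    (square_reflect sq).
subst z; case: (red_p [:: x, w, x & u2]); last exact: backtracks_here.
by apply: swaps_trans pu _; apply: swaps_cons.
Qed.

(** Appending an edge to a reduced path, or cancelling it against its last edge if
    possible.  The choice of the path that remains after cancellation is immaterial
    up to [swaps], by [swaps_cancel]. *)
Definition extend p y : seq Q :=
  if p is x :: _ then
    if pselect (exists s, swaps p [:: x, y & s]) is left ex then y :: projT1 (cid ex)
    else y :: p
  else [:: y].

Lemma extend_back x y p s : swaps (x :: p) [:: x, y & s] ->
  swaps (extend (x :: p) y) (y :: s).
Proof.
move=> h; rewrite /extend; case: pselect => [ex|[]]; last by exists s.
by case: cid => /= s' h'; apply: swaps_cancel (swaps_trans (swaps_sym h') h).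
Qed.

Lemma extend_forth x y p : (forall s, ~ swaps (x :: p) [:: x, y & s]) ->
  extend (x :: p) y = [:: y, x & p].
Proof. by move=> h; rewrite /extend; case: pselect => // ex; exfalso; case: ex => s /h. Qed.

Lemma extend_cases x y p :
  (exists2 s, swaps (x :: p) [:: x, y & s] & swaps (extend (x :: p) y) (y :: s)) \/
  (forall s, ~ swaps (x :: p) [:: x, y & s]) /\ extend (x :: p) y = [:: y, x & p].
Proof.
have [[s h]|h] := pselect (exists s, swaps (x :: p) [:: x, y & s]).
  by left; exists s => //; apply: extend_back.
have h' s : ~ swaps (x :: p) [:: x, y & s] by move=> hs; apply: h; exists s.
by right; split=> //; apply: extend_forth.
Qed.

Lemma extend_head p y : exists p', extend p y = y :: p'.
Proof.
case: p => [|x p]; first by exists [::].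
by rewrite /extend; case: pselect => ?; eexists.
Qed.

Lemma extend_swaps p q y : swaps p q -> swaps (extend p y) (extend q y).
Proof.
case: p => [|x p] pq.
  by case: q pq => [|? ?] /swaps_size// _; exact: swaps_refl.
have [q' ?] := swaps_head pq; subst q.
have [[s ps es]|[ps es]] := extend_cases x y p.
  apply: swaps_trans es _; apply: swaps_sym.
  exact: extend_back (swaps_trans (swaps_sym pq) ps).
rewrite es extend_forth; first exact: swaps_cons.
by move=> s /(swaps_trans pq)/ps.
Qed.

Lemma extend_reduced p y : reduced p -> reduced (extend p y).
Proof.
case: p => [|x p] red_p.
  by move=> q /swaps_size; case: q => [|? []]//= _ bq; inversion bq as [|? ? bn]; inversion bn.
have [[s ps es]|[ps ->]] := extend_cases x y p.
  apply: (reduced_swaps (swaps_sym es)).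
  by apply: (@reduced_tail x); apply: reduced_swaps ps red_p.
by apply: contrapT => /(reduced_extension red_p)[s /ps].
Qed.

Lemma extend_id x p : reduced (x :: p) -> p != [::] -> extend p x = x :: p.
Proof.
case: p => [|y p] // red_p _; apply: extend_forth => s h.
by apply: (red_p _ (swaps_cons x h)); apply: backtracks_here.
Qed.

Lemma extend_backtrack x y p : reduced (x :: p) ->
  swaps (extend (extend (x :: p) y) x) (x :: p).
Proof.
move=> red_p; have [[s ps es]|[ps ->]] := extend_cases x y p; last first.
  exact/extend_back/swaps_refl.
apply: swaps_trans (extend_swaps x es) _.
rewrite extend_forth; first exact: swaps_sym.
move=> s' h; apply: (red_p [:: x, y, x & s']); last exact: backtracks_here.
by apply: swaps_trans ps _; apply: swaps_cons.
Qed.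

(** Whether the two sides of a square cancel against a path is decided by
    [swaps_corner]: in each of the four cases the two ways around the square give the
    same class. *)
Lemma extend_square x y z w p : square x y z w -> reduced (x :: p) ->
  swaps (extend (extend (x :: p) y) z) (extend (extend (x :: p) w) z).
Proof.
have one_back y' w' s : square x y' z w' -> reduced (x :: p) ->
    swaps (x :: p) [:: x, y' & s] -> (forall s, ~ swaps (x :: p) [:: x, w' & s]) ->
    swaps (extend (extend (x :: p) y') z) (extend (extend (x :: p) w') z).
  move=> sq red_p ps pw; apply: swaps_trans (extend_swaps z (extend_back ps)) _.
  rewrite (extend_forth pw) extend_forth; last first.
    move=> t st; apply: (pw (z :: t)); apply: swaps_trans ps _.
    by apply: swaps_trans (swaps_cons x st) _; apply: swaps_square.
  apply/swaps_sym/extend_back; apply: swaps_trans (swaps_cons w' ps) _.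
  exact: swaps_square (square_rot (square_rot (square_rot sq))).
have no_back y' w' : square x y' z w' -> (forall s, ~ swaps (x :: p) [:: x, y' & s]) ->
    (forall s, ~ swaps (x :: p) [:: x, w' & s]) ->
    extend (extend (x :: p) y') z = [:: z, y', x & p].
  move=> sq py pw; rewrite (extend_forth py) extend_forth // => s ys.
  have [_ xz _ _] := square_neq sq.
  have [v [u [sq2 pu _]]] := swaps_corner ys xz.
  have ? : w' = v.
    exact: square_uniq sq (square_rot (square_rot (square_rot (square_reflect sq2)))).
  by subst v; apply: pw pu.
move=> sq red_p.
have [[s ps es]|[py _]] := extend_cases x y p; have [[t pt et]|[pw _]] := extend_cases x w p.
- have [_ _ _ [_ yw _]] := square_neq sq.
  have [v [u [sq2 su tu]]] := swaps_corner (swaps_trans (swaps_sym ps) pt) yw.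
  have ? : z = v.
    exact: square_uniq (square_rot (square_rot (square_rot sq)))
      (square_rot (square_rot (square_rot sq2))).
  subst v; apply: swaps_trans (_ : swaps _ (z :: u)) _; last apply: swaps_sym.
  + by apply: swaps_trans (extend_swaps z es) _; apply: extend_back.
  + by apply: swaps_trans (extend_swaps z et) _; apply: extend_back.
- exact: one_back ps pw.
- by apply/swaps_sym; apply: one_back (square_reflect sq) red_p pt py.
- rewrite (no_back _ _ sq) // (no_back _ _ (square_reflect sq)) //.
  exact: swaps_square (square_rot (square_rot (square_reflect sq))).
Qed.

Local Arguments extend : simpl never.

(** The reduced form of an edge path; [l] is written forwards, its reduced form
    backwards. *)
Definition nf l : seq Q := foldl extend [::] l.

Lemma foldl_extend_swaps p q l : swaps p q ->
  swaps (foldl extend p l) (foldl extend q l).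
Proof. by elim: l p q => //= x l IH p q /(extend_swaps x)/IH. Qed.

Lemma foldl_extend_reduced p l : reduced p -> reduced (foldl extend p l).
Proof. by elim: l p => //= x l IH p /(@extend_reduced _ x)/IH. Qed.

Lemma foldl_extend_head x p l : exists p', foldl extend (x :: p) l = last x l :: p'.
Proof.
elim: l x p => [|y l IH] x p; first by exists p.
by have [p' e] := extend_head (x :: p) y; rewrite [foldl _ _ _]/= e; apply: IH.
Qed.

Lemma nf_reduced l : reduced (nf l).
Proof.
by apply: foldl_extend_reduced => q /swaps_size; case: q => // _ bq; inversion bq.
Qed.

Lemma homotopic_nf l l' : homotopic l l' -> swaps (nf l) (nf l').
Proof.
elim=> {l l'} [s|s t _|s t v _ + _|s t x y _|s t x y z w sq].
- exact: swaps_refl.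
- exact: swaps_sym.
- exact: swaps_trans.
- rewrite /nf !foldl_cat /= -/(nf s); apply: foldl_extend_swaps.
  have [p e] := extend_head (nf s) x.
  have := @extend_reduced _ x (@nf_reduced s); rewrite e; exact: extend_backtrack.
- rewrite /nf !foldl_cat /= -/(nf s); apply: foldl_extend_swaps.
  have [p e] := extend_head (nf s) x.
  by have := @extend_reduced _ x (@nf_reduced s); rewrite e; apply: extend_square.
Qed.

Lemma nf_rev p : reduced p -> nf (rev p) = p.
Proof.
elim: p => // x p IH red_p; rewrite /nf rev_cons foldl_rcons -/(nf _).
rewrite IH; last exact: reduced_tail red_p.
by case: p {IH} red_p => // y p /extend_id; apply.
Qed.

(** Going back along [l] and forth again returns every reduced path to itself, since
    an edge and its inverse cancel. *)
Lemma extend_retrace x p l : reduced (last x l :: p) ->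
  swaps (foldl extend (foldl extend (last x l :: p) (rev (belast x l))) l) (last x l :: p).
Proof.
elim: l x p => [|y l IH] x p; first by move=> _; exact: swaps_refl.
rewrite [last _ _]/= [belast _ _]/= rev_cons foldl_rcons => red_p.
set P := foldl extend _ (rev _).
have [p' e] : exists p', P = y :: p'.
  have [p' e] := foldl_extend_head (last y l) p (rev (belast y l)).
  exists p'; rewrite /P e; congr (_ :: _).
  by case: (l) => //= z l'; rewrite rev_cons last_rcons.
have red_P : reduced P by apply: foldl_extend_reduced.
rewrite [foldl _ _ (y :: l)]/=; apply: swaps_trans (IH y p red_p).
apply: foldl_extend_swaps; rewrite -/P e; apply: extend_backtrack.
by rewrite -e.
Qed.

Hypothesis scQ : simply_connected Q.

Lemma nf_endpoints o l l' : path (@adj Q) o l -> path (@adj Q) o l' ->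
  last o l = last o l' -> swaps (nf (o :: l)) (nf (o :: l')).
Proof.
move=> path_l path_l' eq_last; have [_ contractible] := scQ.
have /homotopic_nf : homotopic (o :: (l ++ rev (belast o l'))) [:: o].
  apply: contractible.
  - rewrite cat_path path_l eq_last rev_path.
    by rewrite (eq_path (e' := @adj Q)) // => x y; rewrite adj_sym.
  - rewrite last_cat eq_last; case: (l') => //= z l''.
    by rewrite rev_cons last_rcons.
rewrite -cat_cons /nf foldl_cat -/(nf _) => /(foldl_extend_swaps l') closed.
apply: swaps_trans (swaps_sym _) closed.
have [p e] := foldl_extend_head o [::] l.
have red := @nf_reduced (o :: l).
by move: red; rewrite /nf /= e eq_last => red; apply: extend_retrace.
Qed.

(** The normal form is a homotopy invariant that fixes reduced paths. *)
Lemma reduced_uniq x o p q :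
  sorted (@adj Q) (x :: p) -> sorted (@adj Q) (x :: q) ->
  last x p = o -> last x q = o -> reduced (x :: p) -> reduced (x :: q) ->
  swaps (x :: p) (x :: q).
Proof.
move=> sp sq lp lq rp rq; rewrite -(nf_rev rp) -(nf_rev rq).
have rE s : last x s = o -> rev (x :: s) = o :: rev (belast x s).
  by move=> <-; rewrite lastI rev_rcons.
rewrite !rE //; apply: nf_endpoints.
- by rewrite -lp rev_path (eq_path (e' := @adj Q)) // => ? ?; rewrite adj_sym.
- by rewrite -lq rev_path (eq_path (e' := @adj Q)) // => ? ?; rewrite adj_sym.
have lE s : last x s = o -> last o (rev (belast x s)) = x.
  by move=> <-; case: s => //= z s'; rewrite rev_cons last_rcons.
by rewrite !lE.
Qed.

End EdgePathWords.

(** * The edge metric and half-spaces *)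

Section EdgeMetric.
Variable Q : cube_complex.
Hypothesis connQ : connected_complex Q.
Implicit Types (x y z w o : Q) (s : seq Q).

Lemma cdist_path x y : path_of_length x y (cdist x y).
Proof.
rewrite /cdist; case: xgetP => [n _ [] //|none].
have [s [ps ls]] := connQ x y.
have ex : exists n, `[< path_of_length x y n >].
  by exists (size s); apply/asboolP; exists s.
case: (ex_minnP ex) => n /asboolP n_path n_min.
by case: (none n); split=> // k /asboolP/n_min.
Qed.

Lemma cdist_min x y k : path_of_length x y k -> (cdist x y <= k)%N.
Proof.
move=> xy; rewrite /cdist; case: xgetP => [n _ [_ /(_ k xy)] //|none].
have ex : exists n, `[< path_of_length x y n >] by exists k; apply/asboolP.
case: (ex_minnP ex) => n /asboolP n_path n_min.
by case: (none n); split=> // m /asboolP/n_min.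
Qed.

Lemma cdist_le x s : path (@adj Q) x s -> (cdist x (last x s) <= size s)%N.
Proof. by move=> ps; apply: cdist_min; exists s. Qed.

Lemma cdist_xx x : cdist x x = 0%N.
Proof. by apply/eqP; rewrite -leqn0; apply: (@cdist_le x [::]). Qed.

Lemma cdist_eq0 x y : cdist x y = 0%N -> x = y.
Proof. by move=> e; have := cdist_path x y; rewrite e => -[[|z s] [_ /= ly]]. Qed.

Lemma cdist_triangle y x z : (cdist x z <= cdist x y + cdist y z)%N.
Proof.
have [s [ps ls <-]] := cdist_path x y; have [t [pt lt <-]] := cdist_path y z.
by apply: cdist_min; exists (s ++ t); rewrite cat_path last_cat ls ps size_cat.
Qed.

Lemma cdistC x y : cdist x y = cdist y x.
Proof.
suff le (u v : Q) : (cdist u v <= cdist v u)%N by apply/eqP; rewrite eqn_leq !le.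
have [s [ps ls <-]] := cdist_path v u.
apply: cdist_min; exists (rev (belast v s)); split.
- by rewrite -ls rev_path (eq_path (e' := @adj Q)) // => ? ?; rewrite adj_sym.
- by rewrite -ls; case: (s) => //= z s'; rewrite rev_cons last_rcons.
- by rewrite size_rev size_belast.
Qed.

Lemma cdist_adj_le x y : adj x y -> (cdist x y <= 1)%N.
Proof. by move=> xy; apply: (@cdist_le x [:: y]); rewrite /= xy. Qed.

Lemma cdist_step x y n : cdist x y = n.+1 -> exists2 z, adj x z & cdist z y = n.
Proof.
move=> e; have [[|z s] [/= + ls]] := cdist_path x y; rewrite e // => /andP[xz ps] [sz].
exists z => //; have := cdist_triangle z x y; rewrite e.
have := cdist_adj_le xz; have := cdist_le ps; rewrite ls; lia.
Qed.

Definition between x p y := (cdist x p + cdist p y)%N = cdist x y.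

Lemma on_geodesicP x y p : on_geodesic x y p <-> between x p y.
Proof.
split=> [[s [ps ls ss]]|].
  rewrite inE => /predU1P[->|]; first by rewrite /between cdist_xx.
  move: ps ls ss => + + + /splitPr ps; case: ps => s1 s2.
  rewrite cat_path last_cat /= => /and3P[p1 lp p2] l2.
  rewrite size_cat /= => ss.
  have /cdist_le : path (@adj Q) x (rcons s1 p) by rewrite rcons_path p1.
  rewrite last_rcons size_rcons; have := cdist_le p2; rewrite l2.
  by have := cdist_triangle p x y; rewrite /between; lia.
have [s [ps ls es]] := cdist_path x p; have [t [pt lt et]] := cdist_path p y.
move=> xpy; exists (s ++ t); rewrite cat_path last_cat ls ps size_cat es et; split=> //.
by rewrite -cat_cons mem_cat -{1}ls mem_last.
Qed.

End EdgeMetric.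

Section CAT0Graph.
Variable Q : cube_complex.
Hypothesis catQ : CAT0 Q.
Implicit Types (x y z w o p q a b : Q) (s : seq Q).

Let scQ : simply_connected Q := catQ.1.
Let flagQ : flag_links Q := catQ.2.
Let connQ : connected_complex Q := scQ.1.
Let triangle := cdist_triangle connQ.
Let symm := cdistC connQ.

Lemma backtracks_shorten x s : backtracks (x :: s) -> sorted (@adj Q) (x :: s) ->
  exists s', [/\ path (@adj Q) x s', last x s' = last x s & (size s').+2 = size s].
Proof.
move eq_l : (x :: s) => l bl; elim: bl x s eq_l => {l} [x y s|y l bl IH] x' s'.
  by case=> -> -> /= /and3P[_ _ ps]; exists s.
case=> ? ?; subst y s'; case: l bl IH => [|y l] bl IH; first by inversion bl.
move=> /= /andP[xy pl]; have [s [ps ls ss]] := IH y l (erefl _) pl.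
by exists (y :: s); rewrite /= xy ps ls -ss.
Qed.

(** Geodesics are reduced, since a backtrack could be cut out. *)
Lemma geodesic_word o x : exists s, [/\ sorted (@adj Q) (x :: s), last x s = o,
  size s = cdist o x & reduced (x :: s)].
Proof.
have [s [ps ls ss]] := cdist_path connQ x o.
exists s; split=> //; first by rewrite symm.
move=> q xq bq; have [q' ?] := swaps_head xq; subst q.
have [s' [ps' ls' ss']] := backtracks_shorten bq (swaps_sorted xq ps).
have := cdist_le ps'; rewrite ls'.
by have /= <- := swaps_last x xq; have /= [] := swaps_size xq; rewrite ls; lia.
Qed.

Lemma reduced_geodesic o x s : sorted (@adj Q) (x :: s) -> last x s = o ->
  reduced (x :: s) -> size s = cdist o x.
Proof.
move=> ss ls rs; have [t [st lt <- rt]] := geodesic_word o x.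
by have /swaps_size/= [] := reduced_uniq flagQ scQ ss st ls lt rs rt.
Qed.

(** Appending an edge to a reduced path changes its length by one. *)
Lemma cdist_adj o x y : adj x y ->
  cdist o y = (cdist o x).+1 \/ cdist o x = (cdist o y).+1.
Proof.
move=> xy; have [s [ss ls <- rs]] := geodesic_word o x.
have [[t st _]|[_ ext]] := extend_cases flagQ x y s.
  have := swaps_size st => -[->]; right; congr _.+1.
  apply: reduced_geodesic; last exact: reduced_tail (reduced_swaps st rs).
    by have /= /andP[] := swaps_sorted st ss.
  by have /= <- := swaps_last x st.
left; rewrite -(@reduced_geodesic o y (x :: s)) //.
  by rewrite /= adj_sym xy.
by have := @extend_reduced _ flagQ _ y rs; rewrite ext.
Qed.

Lemma cdist_adj1 x y : adj x y -> cdist x y = 1%N.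
Proof. by move=> xy; have := cdist_adj x xy; rewrite cdist_xx //; lia. Qed.

(** The quadrangle condition: geodesics from [o] through [y] and through [y'] to [x]
    are equivalent, and their last edges differ. *)
Lemma quadrangle o x y y' k : adj x y -> adj x y' -> y != y' ->
  cdist o x = k.+1 -> cdist o y = k -> cdist o y' = k ->
  exists2 w, square x y w y' & (cdist o w).+1 = k.
Proof.
move=> xy xy' yy' dx dy dy'.
have word z : adj x z -> cdist o z = k -> exists s,
    [/\ sorted (@adj Q) [:: x, z & s], last z s = o & reduced [:: x, z & s]].
  move=> xz dz; have [s [ss ls es rs]] := geodesic_word o z.
  exists s; split=> //; first by rewrite /= xz.
  have [[t st et]|[_ ext]] := extend_cases flagQ z x s.
    have sx : sorted (@adj Q) (x :: t) by have /= /andP[] := swaps_sorted st ss.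
    have lx : last x t = o by have /= <- := swaps_last z st.
    have := reduced_geodesic sx lx (reduced_tail (reduced_swaps st rs)).
    by have /= [] := swaps_size st; lia.
  by have := @extend_reduced _ flagQ _ x rs; rewrite ext.
have [s [ss ls rs]] := word y xy dy; have [t [st lt rt]] := word y' xy' dy'.
have [w [u [sq hs _]]] := swaps_corner flagQ (reduced_uniq flagQ scQ ss st ls lt rs rt) yy'.
exists w => //.
have sw : sorted (@adj Q) (w :: u).
  by have /= /andP[] : sorted (@adj Q) [:: y, w & u]
    by apply: swaps_sorted hs _; move: ss => /= /andP[].
have lw : last w u = o by have /= <- := swaps_last y hs.
rewrite -(reduced_geodesic sw lw).
  have /= [<-] := swaps_size hs; rewrite -dy; apply: reduced_geodesic => //.
    by move: ss => /= /andP[].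
  exact: reduced_tail rs.
exact: reduced_tail (reduced_swaps hs (reduced_tail rs)).
Qed.

(** By the quadrangle condition any two of the common neighbours lie on a square with
    [x] and [z], and squares sharing three vertices coincide. *)
Lemma two_common_neighbours x z a b c : x != z ->
  adj x a -> adj x b -> adj x c -> adj z a -> adj z b -> adj z c ->
  a != b -> a != c -> b = c.
Proof.
move=> xz xa xb xc za zb zc ab ac.
have dz y : adj z y -> cdist z y = 1%N by apply: cdist_adj1.
have dx : cdist z x = 2%N.
  have ax : adj a x by rewrite adj_sym.
  have := cdist_adj z ax; rewrite (dz a) // => -[] // [] e.
  by move: xz; rewrite (cdist_eq0 connQ (esym e)) eqxx.
have corner y : adj x y -> adj z y -> a != y -> square x a z y.
  move=> xy zy ay; have [w sq [dw]] := quadrangle xa xy ay dx (dz _ za) (dz _ zy).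
  by rewrite (cdist_eq0 connQ dw).
exact: square_uniq (corner b xb zb ab) (corner c xc zc ac).
Qed.

(** For an edge from [a] to [b], [closer a b] and [closer b a] are the two half-spaces
    that it separates. *)
Definition closer a b p := (cdist p a < cdist p b)%N.

Lemma closer_total a b p : adj a b -> closer a b p \/ closer b a p.
Proof. by move=> /(cdist_adj p); rewrite /closer; lia. Qed.

Lemma closer_asym a b p : closer a b p -> ~ closer b a p.
Proof. by rewrite /closer; lia. Qed.

(** Otherwise [x] and [y'] would be two vertices at the same distance from [p] with
    the common neighbours [x'] and [y] farther from [p], and by the quadrangle
    condition a third one nearer to [p]. *)
Lemma square_closer x x' y' y p : square x x' y' y -> closer x y p -> closer x' y' p.
Proof.
move=> sq; have [xx' x'y' y'y yx] := square_adj sq.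
case: (closer_total p x'y') => // /[swap].
have := cdist_adj p xx'; have := cdist_adj p y'y; have := cdist_adj p yx.
rewrite /closer => d1 d2 d3 lt1 lt2; exfalso.
have dx : cdist p y = (cdist p x).+1 by lia.
have dy' : cdist p y' = cdist p x by lia.
have dx' : cdist p x' = (cdist p x).+1 by lia.
have [_ xy' _ [_ x'y _]] := square_neq sq.
have yy' : adj y y' by rewrite adj_sym.
have [w sq' dw] := quadrangle yx yy' xy' dx (erefl _) dy'.
have [_ xw wy' _] := square_adj sq'.
have yw : y != w by apply/eqP => e; move: dw dx; rewrite -e; lia.
have x'w : x' = w.
  by apply: (@two_common_neighbours x y' y) => //; rewrite 1?adj_sym // eq_sym.
by move: dw dx'; rewrite x'w; lia.
Qed.

(** The two edges are the ends of a ladder of squares, built from [x] towards [a] by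
    the quadrangle condition with respect to [b]. *)
Lemma ladder_closer a b x y p : adj a b -> adj x y -> cdist x a = cdist y b ->
  cdist x b = (cdist x a).+1 -> cdist y a = (cdist x a).+1 ->
  closer a b p <-> closer x y p.
Proof.
move=> ab; move eq_k : (cdist x a) => k.
elim: k => [|k IHk] in x y eq_k *.
  by move=> _ /esym/(cdist_eq0 connQ) <- _ _; rewrite (cdist_eq0 connQ eq_k).
move=> xy /esym dyb dxb dya.
have [x' xx' dx'a] := cdist_step connQ eq_k.
have dx'b : cdist x' b = k.+1.
  have := cdist_adj b xx'; have := triangle a x' b.
  by rewrite dx'a (cdist_adj1 ab) !(symm b) dxb; lia.
have neq : x' != y by apply/eqP => e; move: dya; rewrite -e dx'a; lia.
have [|||w sq dw] := @quadrangle b x x' y k.+1 xx' xy neq; rewrite 1?symm //.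
have [_ x'w wy _] := square_adj sq.
have dwb : cdist w b = k by move: dw; rewrite symm => -[].
have dwa : cdist w a = k.+1.
  have := cdist_adj a x'w; have := cdist_adj a wy; rewrite !(symm a) dx'a dya.
  by lia.
have IH := IHk x' w dx'a x'w (esym dwb) dx'b dwa.
apply: (iff_trans IH); split=> h; last exact: square_closer sq h.
exact: square_closer (square_reflect (square_rot sq)) h.
Qed.

(** A geodesic leaving the half-space does so along an edge joined by a ladder to the
    given one; such an edge leads away from [y]. *)
Lemma closer_convex a b x p y : adj a b -> closer a b x -> closer a b y ->
  between x p y -> closer a b p.
Proof.
move=> ab; move eq_n : (cdist x p) => n; elim: n => [|n IHn] in x eq_n *.
  by rewrite (cdist_eq0 connQ eq_n).
move=> ax ay xpy; have [z xz zp] := cdist_step connQ eq_n.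
have xzy : cdist x y = (cdist z y).+1.
  have := triangle z x y; have := triangle p z y; rewrite (cdist_adj1 xz) zp.
  by move: xpy; rewrite /between eq_n; lia.
have [az|bz] := closer_total z ab.
  by apply: (IHn z) => //; move: xpy; rewrite /between eq_n zp xzy; lia.
have := cdist_adj a xz; have := cdist_adj b xz; have := cdist_adj x ab.
have := cdist_adj z ab; rewrite !(symm a) !(symm b) => d1 d2 d3 d4.
have e0 : cdist x a = cdist z b by move: ax bz; rewrite /closer; lia.
have e1 : cdist x b = (cdist x a).+1 by move: ax bz; rewrite /closer; lia.
have e2 : cdist z a = (cdist x a).+1 by move: ax bz; rewrite /closer; lia.
have [h _] := ladder_closer y ab xz e0 e1 e2.
by move: (h ay); rewrite /closer !(symm y) xzy; lia.
Qed.

End CAT0Graph.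

(** * Medians and convex hulls *)

Section CAT0Median.
Variable Q : cube_complex.
Hypothesis catQ : CAT0 Q.
Implicit Types (x y z w o p q a b c : Q) (s : seq Q).

Let scQ : simply_connected Q := catQ.1.
Let flagQ : flag_links Q := catQ.2.
Let connQ : connected_complex Q := scQ.1.
Let triangle := cdist_triangle connQ.
Let symm := cdistC connQ.

(** A geodesic from [x] to [y] that does not start towards [z] moves away from
    [z] all along: at a first turn back, a square would replace it by a geodesic
    that turns back earlier. *)
Lemma between_of_disjoint x y z :
  (forall p, between x p y -> between x p z -> p = x) -> between y x z.
Proof.
move=> disj.
have away i c : between x c y -> cdist x c = i -> cdist z c = (cdist z x + i)%N.
  have [n] := ubnP i; elim: n => // n IHn in i c *.
  case: i => [_ _ e|[_ xcy e|i lt_i xcy e]].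
  - by rewrite -(cdist_eq0 connQ e) addn0.
  - have [c' xc' /(cdist_eq0 connQ) ?] := cdist_step connQ e; subst c'.
    case: (cdist_adj catQ z xc') => dz; first by rewrite dz addn1.
    suff cx : c = x by move: e; rewrite cx cdist_xx.
    by apply: disj => //; rewrite /between e !(symm _ z) dz; lia.
  - have e' : cdist c x = i.+2 by rewrite symm.
    have [b cb db] := cdist_step connQ e'.
    have [a ba da] := cdist_step connQ db.
    rewrite (symm b) in db; rewrite (symm a) in da.
    have xby : between x b y.
      have := triangle c b y; have := triangle b x y; rewrite (cdist_adj1 catQ (_ : adj b c)).
        by move: xcy; rewrite /between e db; lia.
      by rewrite adj_sym.
    have xay : between x a y.
      have := triangle b a y; have := triangle a x y; rewrite (cdist_adj1 catQ (_ : adj a b)).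
        by move: xby; rewrite /between da db; lia.
      by rewrite adj_sym.
    have zb : cdist z b = (cdist z x + i.+1)%N by apply: IHn => //; lia.
    have za : cdist z a = (cdist z x + i)%N by apply: IHn => //; lia.
    have bc : adj b c by rewrite adj_sym.
    have [zc|zc] := cdist_adj catQ z bc; first by rewrite zc zb; lia.
    have ac : a != c by apply/eqP => ac; move: da e; rewrite ac; lia.
    have zb' : cdist z b = (cdist z x + i).+1 by lia.
    have [|w sq dw] := quadrangle catQ ba bc ac zb' za; first by lia.
    have [_ aw wc _] := square_adj sq.
    have xw : cdist x w = i.+1.
      by have := cdist_adj catQ x aw; have := cdist_adj catQ x wc; rewrite da e; lia.
    have xwy : between x w y.
      have := triangle c w y; have := triangle w x y; rewrite (cdist_adj1 catQ wc).
      by move: xcy; rewrite /between e xw; lia.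
    have : cdist z w = (cdist z x + i.+1)%N by apply: IHn => //; lia.
    by move: dw; lia.
have xyy : between x y y by rewrite /between cdist_xx addn0.
have := away _ _ xyy (erefl _); rewrite /between (symm y z) => ->.
by rewrite (symm y x) (symm x z) addnC.
Qed.

Lemma between_trans x p q y : between x p y -> between p q y ->
  between x q y /\ cdist x q = (cdist x p + cdist p q)%N.
Proof.
have := triangle p x q; have := triangle q x y; rewrite /between; lia.
Qed.

(** Leave [x] towards both [y] and [z] for as long as possible. *)
Lemma median_exists x y z :
  exists p, [/\ between x p y, between y p z & between x p z].
Proof.
pose P n := `[< exists p, [/\ between x p y, between x p z & cdist x p = n] >].
have exP : exists n, P n.
  by exists 0%N; apply/asboolP; exists x; rewrite /between cdist_xx.
have ubP n : P n -> (n <= cdist x y)%N.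
  by move=> /asboolP[p [xpy _ <-]]; move: xpy; rewrite /between; lia.
case: (ex_maxnP exP ubP) => n /asboolP[p [xpy xpz dp]] max_n.
exists p; split=> //; apply: between_of_disjoint => q pqy pqz.
have [xqy dq] := between_trans xpy pqy; have [xqz _] := between_trans xpz pqz.
have /max_n : P (cdist x q) by apply/asboolP; exists q.
by rewrite dq dp => le; apply/esym/(cdist_eq0 connQ); lia.
Qed.

Lemma separated p q : p <> q -> exists a b, [/\ adj a b, closer a b p & closer b a q].
Proof.
move=> pq; case e : (cdist p q) => [|n]; first by case: pq; apply: cdist_eq0 e.
have [b pb bq] := cdist_step connQ e; exists p, b; split=> //.
  by rewrite /closer cdist_xx (cdist_adj1 catQ pb).
by rewrite /closer !(symm q) e bq.
Qed.

(** A half-space between two medians would contain two of the three points, hence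
    by convexity both medians. *)
Lemma median_uniq x y z p q :
  between x p y -> between y p z -> between x p z ->
  between x q y -> between y q z -> between x q z -> p = q.
Proof.
move=> p1 p2 p3 q1 q2 q3; apply: contrapT => /separated[a [b [ab ap bq]]].
have ba : adj b a by rewrite adj_sym.
have := closer_convex catQ ab; have := closer_convex catQ ba.
move: (closer_asym ap) (closer_asym bq) => nbp naq cb ca.
case: (closer_total catQ x ab) (closer_total catQ y ab) (closer_total catQ z ab).
  move=> ax [ay _|by_ [az|bz]]; [exact/naq/(ca _ _ _ ax ay)|exact/naq/(ca _ _ _ ax az)|
    exact/nbp/(cb _ _ _ by_ bz)].
move=> bx [ay [az|bz]|by_ _]; [exact/naq/(ca _ _ _ ay az)|exact/nbp/(cb _ _ _ bx bz)|
    exact/nbp/(cb _ _ _ bx by_)].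
Qed.

Lemma cmedP x y z : [/\ between x (cmed x y z) y, between y (cmed x y z) z
  & between x (cmed x y z) z].
Proof.
have [p [/(on_geodesicP connQ) p1 /(on_geodesicP connQ) p2 /(on_geodesicP connQ) p3]] :=
  median_exists x y z.
rewrite /cmed; case: xgetP => [q _ [q1 q2 q3]|/(_ p)[]//].
by split; apply/(on_geodesicP connQ).
Qed.

Lemma cmed_uniq x y z p :
  between x p y -> between y p z -> between x p z -> cmed x y z = p.
Proof. by have [m1 m2 m3] := cmedP x y z; exact: median_uniq. Qed.

Lemma cmed_xxz x z : cmed x x z = x.
Proof. by apply: cmed_uniq; rewrite /between ?cdist_xx. Qed.

Lemma cmed_closer a b x y z : adj a b ->
  (closer a b x /\ closer a b y) \/ (closer a b y /\ closer a b z) \/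
  (closer a b x /\ closer a b z) -> closer a b (cmed x y z).
Proof.
have [m1 m2 m3] := cmedP x y z; move=> ab.
by case=> [|[]] [h h']; [apply: closer_convex m1|apply: closer_convex m2|
  apply: closer_convex m3].
Qed.

(** The edges at [c] that lead towards [p] span squares pairwise, by the quadrangle
    condition, and hence a cube. *)
Lemma closer_neighbours_dim r c p s : dim_le Q r -> uniq s ->
  (forall y, y \in s -> adj c y /\ closer y c p) -> (size s <= r)%N.
Proof.
move=> dimQ uniq_s near_p.
have [||y z sy sz|C [cC Cc E]] := flagQ (x := c) (S := [set y | y \in s]).
- exact: finite_seq.
- by move=> y /near_p[].
- have [<-|yz] := eqVneq y z; first by apply: edge_link; have [] := near_p y sy.
  have [cy py] := near_p y sy; have [cz pz] := near_p z sz.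
  have dc t : adj c t -> closer t c p -> cdist p c = (cdist p t).+1.
    by move=> /(cdist_adj catQ p); rewrite /closer; lia.
  have [|w sq _] := quadrangle catQ cy cz yz (dc _ cy py) (erefl _); last first.
    exact: square_link sq.
  by have := dc _ cy py; rewrite (dc _ cz pz) => -[].
have [n [phi ch]] := cubes_chart cC; have [phi_inj rphi _] := ch.
have [u _ cE] : range phi c by rewrite rphi.
apply: leq_trans (_ : (n <= r)%N); last by apply: (dimQ n C); split=> //; exists phi.
rewrite -[n in (_ <= n)%N]size_enum_ord -(size_map (fun i => phi (flip u i))).
apply: uniq_leq_size => // y sy.
have : [set y | y \in s] y by [].
rewrite E -cE => /(chart_link ch)[i ->].
by apply: map_f; rewrite mem_enum.
Qed.

Lemma join_closer a b n (A : set Q) c : adj a b -> (forall x, A x -> closer a b x) ->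
  iter n (median_join (@cmed Q)) A c -> closer a b c.
Proof.
move=> ab Aab; elim: n c => [|n IHn] c /=; first exact: Aab.
move=> [x /IHn ax [y /IHn ay [z _ <-]]].
by apply: cmed_closer => //; left.
Qed.

(** In dimension [r] a point [c] of the convex hull of [A] is reached from any point
    of [A] in [r] steps, each towards a point of [A]: as long as some edge at [c]
    leads towards the current point, [A] has a point behind that edge, and the median
    with this point and [c] has fewer such edges, of which there are at most [r]. *)
Lemma hull_reached r n (A : set Q) c : dim_le Q r ->
  iter n (median_join (@cmed Q)) A c ->
  exists a bs, [/\ A a, forall b, b \in bs -> A b, size bs = r
    & foldl (fun p b => cmed p b c) a bs = c].
Proof.
move=> dimQ Jc.
have [a Aa] : A !=set0.
  by elim: n {+}c Jc => [|n IHn] x /=; [exists x | move=> [y /IHn]].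
pose few k p := forall s, uniq s ->
  (forall y, y \in s -> adj c y /\ closer y c p) -> (size s <= k)%N.
have few_c k : few k c.
  move=> [|y s] // _ /(_ y); rewrite inE eqxx => /(_ isT)[_].
  by rewrite /closer cdist_xx ltn0.
suff reach k p : few k p -> exists bs, [/\ forall b, b \in bs -> A b, size bs = k
    & foldl (fun p b => cmed p b c) p bs = c].
  have [|bs [Abs sbs ebs]] := reach r a; last by exists a, bs.
  by move=> s; apply: closer_neighbours_dim.
have toward q : q <> c -> exists2 y, adj c y & closer y c q.
  move=> qc; case e : (cdist c q) => [|j]; first by case: qc; rewrite (cdist_eq0 connQ e).
  have [y cy yq] := cdist_step connQ e; exists y => //.
  by rewrite /closer !(symm q) e yq.
elim: k p => [|k IHk] p few_p.
  exists [::]; split=> //=; apply: contrapT => /toward[y cy yp].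
  suff : (size [:: y] <= 0)%N by [].
  by apply: few_p => // z; rewrite inE => /eqP ->.
suff [b Ab few_b] : exists2 b, A b & few k (cmed p b c).
  have [bs [Abs sbs ebs]] := IHk _ few_b.
  by exists (b :: bs); split=> [z||]; rewrite /= ?sbs // inE => /predU1P[->|/Abs].
have [->|/toward[y cy yp]] := pselect (p = c).
  exists a => //; suff -> : cmed c a c = c by apply: few_c.
  by apply: cmed_uniq; rewrite /between ?cdist_xx ?addn0.
have yc : adj y c by rewrite adj_sym.
have [b Ab cyb] : exists2 b, A b & closer c y b.
  apply: contrapT => none; have : closer y c c.
    apply: (join_closer yc _ Jc) => x Ax; case: (closer_total catQ x yc) => // cyx.
    by case: none; exists x.
  by rewrite /closer cdist_xx ltn0.
have side z : adj c z -> closer c z c.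
  by move=> cz; rewrite /closer cdist_xx (cdist_adj1 catQ cz).
exists b => // s uniq_s near_s.
suff : (size (y :: s) <= k.+1)%N by [].
apply: few_p => [|z]; first rewrite /= uniq_s andbT.
  apply/negP => /near_s[_ ym]; apply: (closer_asym ym).
  by apply: cmed_closer => //; right; left; split=> //; apply: side.
rewrite inE => /predU1P[-> //|/near_s[cz zm]]; split=> //.
have zc : adj z c by rewrite adj_sym.
case: (closer_total catQ p zc) => // czp; case: (closer_asym zm).
by apply: cmed_closer => //; right; right; split=> //; apply: side.
Qed.

End CAT0Median.

(** * Contracting loops *)

Section RankContraction.
Variable Q : cube_complex.
Variables (o : Q) (rk : Q -> nat).
Hypothesis rk_o : rk o = 0%N.
Hypothesis rk_adj : forall x y, adj x y -> rk y = (rk x).+1 \/ rk x = (rk y).+1.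
Hypothesis rk_quadrangle : forall x y y', adj x y -> adj x y' -> y != y' ->
  rk x = (rk y).+1 -> rk x = (rk y').+1 ->
  exists2 w, square x y w y' & rk y = (rk w).+1.

Lemma rank_peak (x y : Q) s : path (@adj Q) x (y :: s) -> rk y = (rk x).+1 ->
  (rk (last y s) <= rk x)%N -> exists s1 a p b s2,
    [/\ [:: x, y & s] = s1 ++ [:: a, p, b & s2], rk p = (rk a).+1 & rk p = (rk b).+1].
Proof.
elim: s x y => [|z s IH] x y /=; first by move=> _ ->; rewrite ltnn.
move=> /and3P[xy yz ps] rky rkl; have [rkz|rkz] := rk_adj yz; last first.
  by exists [::], x, y, z, s.
have [||s1 [a [p [b [s2 [e e1 e2]]]]]] := IH y z _ rkz; first by rewrite /= yz.
  by rewrite rky ltnW.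
by exists (x :: s1), a, p, b, s2; rewrite e.
Qed.

(** A loop is contracted from its highest points down: each of them is bypassed by
    a square, or is a backtrack. *)
Lemma rank_contraction s : path (@adj Q) o s -> last o s = o -> homotopic (o :: s) [:: o].
Proof.
have [n] := ubnP (sumn (map rk s)); elim: n => // n IHn in s *.
case: s => [|y s]; first by move=> *; exact: homotopic_refl.
move=> lt_n path_s last_s.
have oy : adj o y by move: path_s => /= /andP[].
have rky : rk y = (rk o).+1 by case: (rk_adj oy); rewrite rk_o.
have [|s1 [a [p [b [s2 [e ea eb]]]]]] := rank_peak path_s rky.
  by move: last_s => /= ->.
have /= sorted_l : sorted (@adj Q) (s1 ++ [:: a, p, b & s2]) by rewrite -e.
move: sorted_l; rewrite sorted_cat_cons => /andP[sorted1 /= /and3P[ap pb path2]].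
have conclude t : homotopic (s1 ++ [:: a, p, b & s2]) (s1 ++ [:: a & t]) ->
    path (@adj Q) a t -> last a t = last b s2 ->
    (sumn (map rk t) < rk p + rk b + sumn (map rk s2))%N ->
    homotopic [:: o, y & s] [:: o].
  move=> hom patht lastt sumt; rewrite e; apply: homotopic_trans hom _.
  case: s1 e sorted1 => [|o' s1] e sorted1.
    have [eo es] : o = a /\ y :: s = [:: p, b & s2] by case: e => -> -> ->.
    rewrite -eo; apply: (IHn t).
    - by move: lt_n; rewrite es /= => lt_n; lia.
    - by rewrite eo.
    - by rewrite eo lastt -eo -[RHS]last_s es.
  have [eo es] : o = o' /\ y :: s = s1 ++ [:: a, p, b & s2] by case: e => -> ->.
  rewrite -eo in sorted1 *; rewrite cat_cons; apply: (IHn (s1 ++ a :: t)).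
  - by move: lt_n; rewrite es !map_cat !sumn_cat /=; lia.
  - by rewrite cat_path; move: sorted1; rewrite /= rcons_path => /andP[-> ->].
  - by rewrite last_cat /= lastt -[RHS]last_s es last_cat.
have [eab|neab] := eqVneq a b.
  subst b; apply: (conclude s2) => //; last by rewrite ea; lia.
  exact: homotopic_backtrack.
have pa : adj p a by rewrite adj_sym.
have [w sq ew] := rk_quadrangle pa pb neab ea eb.
have [_ aw wb _] := square_adj sq.
apply: (conclude [:: w, b & s2]); rewrite /= ?aw ?wb //; last by rewrite ea ew; lia.
apply: (@homotopic_square Q s1 s2 a p b w).
exact: square_rot (square_rot (square_rot (square_reflect sq))).
Qed.

End RankContraction.

Section CubeDiameter.
Variable Q : cube_complex.
Hypothesis connQ : connected_complex Q.

Lemma chart_cdist n (phi : {ffun 'I_n -> bool} -> Q) C (u u' : {ffun 'I_n -> bool}) :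
  cube_chart (@cubes Q) phi C -> (cdist (phi u) (phi u') <= n)%N.
Proof.
(* [w s] is [u] with the coordinates in [s] changed to those of [u'] *)
move=> ch; pose w (s : seq 'I_n) := [ffun i => if i \in s then u' i else u i].
have w_le s : (cdist (phi u) (phi (w s)) <= size s)%N.
  elim: s => [|i s IH].
    by rewrite (_ : w [::] = u) ?cdist_xx //; apply/ffunP => i; rewrite ffunE.
  have [->|->] : w (i :: s) = w s \/ w (i :: s) = flip (w s) i.
  - have [e|ne] := eqVneq (u' i) (w s i); [left|right]; apply/ffunP => j;
      rewrite !ffunE inE; have [->|] := eqVneq j i; rewrite /= ?addbF //.
    + by move: e; rewrite ffunE.
    + by move: ne; rewrite ffunE; case: (u' i); case: (if _ then _ else _).
  - exact: leqW.
  have := cdist_triangle connQ (phi (w s)) (phi u) (phi (flip (w s) i)).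
  by have := cdist_adj_le (chart_adj ch (w s) i); move: IH => /=; lia.
have := w_le (enum 'I_n); rewrite size_enum_ord (_ : w _ = u') //.
by apply/ffunP => i; rewrite ffunE mem_enum.
Qed.

Lemma cube_cdist v (C : set Q) x y : dim_le Q v -> cubes C -> C x -> C y ->
  (cdist x y <= v)%N.
Proof.
move=> dimQ cC; have [n [phi ch]] := cubes_chart cC; have [_ <- _] := ch.
move=> [u _ <-] [u' _ <-]; apply: leq_trans (chart_cdist u u' ch) _.
by apply: (dimQ n C); split=> //; exists phi.
Qed.

End CubeDiameter.

(** * Ultraproducts *)

Section Ultraproduct.
Variables (Q : nat -> cube_complex) (o : forall t, Q t) (v : nat).
Variables (U : set_system nat).
Hypothesis UU : UltraFilter U.
Hypothesis catQ : forall t, CAT0 (Q t).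
Hypothesis dimQ : forall t, dim_le (Q t) v.

Let connQ t : connected_complex (Q t) := (catQ t).1.1.

Lemma ultra_not (P : set nat) : ~ U P -> U (~` P).
Proof. by case: (in_ultra_setVsetC P UU). Qed.

Lemma ultra_or (P P' : set nat) : U (P `|` P') -> U P \/ U P'.
Proof.
move=> PP'; have [UP|/ultra_not nP] := pselect (U P); [by left|right].
by apply: filterS2 PP' nP => t [].
Qed.

Lemma ultra_exists (I : finType) (P : I -> nat -> Prop) :
  U [set t | exists i, P i t] -> exists i, U (P i).
Proof.
move=> ex; apply: contrapT => none.
have : U [set t | forall i, (~` P i) t].
  by apply: filter_forall => i; apply: ultra_not => Pi; apply: none; exists i.
by move=> /(filterI ex)/filter_ex[t [[i Pi] /(_ i)]].
Qed.

Lemma ultra_seq (T : eqType) (s : seq T) (P : T -> nat -> Prop) :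
  (forall y, y \in s -> U (P y)) -> U [set t | forall y, y \in s -> P y t].
Proof.
elim: s => [|y s IH] Ps; first by apply: filterS filterT => t _ y.
have Py : U (P y) by apply: Ps; rewrite mem_head.
have Ps' : U [set t | forall y, y \in s -> P y t].
  by apply: IH => z zs; apply: Ps; rewrite inE zs orbT.
by apply: filterS2 Py Ps' => t Pyt Pst z; rewrite inE => /predU1P[->|/Pst].
Qed.

Lemma ultra_bounded (f : nat -> nat) n : U [set t | (f t <= n)%N] ->
  exists m, U [set t | f t = m].
Proof.
move=> fn; have [|i Ui] := @ultra_exists 'I_n.+1 (fun i t => f t = i); last by exists i.
apply: filterS fn => t /= fn; exists (inord (f t)).
by rewrite inordK.
Qed.

(** Vertices of the ultraproduct are classes of sequences that stay at bounded distance
    from the base point [o], almost everywhere for the ultrafilter [U].  A class is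
    represented by a chosen member [urepr], so that equality of vertices is equality
    and they form a choice type. *)
Definition useq := {classic (forall t, Q t)}.

Definition tame (s : useq) :=
  exists n, U [set t | (cdist (o t) (s t) <= n)%N].

Definition urepr (s : useq) : useq :=
  xget (o : useq) [set s' : useq | U [set t | s t = s' t]].

Definition uvert := {s : useq | `[< tame s /\ urepr s = s >]}.

Definition uval (x : uvert) t : Q t := sval x t.

Lemma uval_tame x : tame (uval x).
Proof. by have /asboolP[] := svalP x. Qed.

Lemma uclass (s : useq) : tame s -> exists x, U [set t | uval x t = s t].
Proof.
move=> tame_s.
have repr_s : U [set t | s t = urepr s t].
  apply: (@xgetPex useq o [set s' : useq | U [set t | s t = s' t]]).
  by exists s; apply: filterS filterT.
suff P : `[< tame (urepr s) /\ urepr (urepr s) = urepr s >].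
  by exists (exist _ (urepr s) P); apply: filterS repr_s => t /= ->.
apply/asboolP; split.
  by have [n sn] := tame_s; exists n; apply: filterS2 repr_s sn => t /= ->.
congr xget; apply/seteqP; split=> s' h /=; apply: filterS2 repr_s h => t /= -> //.
Qed.

Lemma uvert_eq x y : U [set t | uval x t = uval y t] -> x = y.
Proof.
move=> xy; apply: val_inj => /=.
have /asboolP[_ <-] := svalP x; have /asboolP[_ <-] := svalP y.
congr xget; apply/seteqP; split=> s' h /=; apply: filterS2 xy h => t /=.
  by rewrite /uval => ->.
by rewrite /uval => ->.
Qed.

(** A family of sets that are almost all nonempty has a vertex in common with almost
    all of them, provided it keeps near the base point. *)
Lemma uval_choice (P : forall t, set (Q t)) :
  U [set t | exists x, P t x] ->
  (exists n, U [set t | forall x, P t x -> (cdist (o t) x <= n)%N]) ->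
  exists x, U [set t | P t (uval x t)].
Proof.
move=> exP [n bndP].
have ex : U [set t | P t (xget (o t) (P t))].
  by apply: filterS exP => t /= /xgetPex.
have [|x ux] := @uclass (fun t => xget (o t) (P t)).
  by exists n; apply: filterS2 bndP ex => t /= bnd /bnd.
by exists x; apply: filterS2 ex ux => t /= + ->.
Qed.

(** The internal sets of the ultraproduct. *)
Definition ulim (C : forall t, set (Q t)) : set uvert :=
  [set x | U [set t | C t (uval x t)]].

Definition bounded_family (C : forall t, set (Q t)) :=
  exists n, U [set t | forall x, C t x -> (cdist (o t) x <= n)%N].

Lemma ulim_subset C D : U [set t | C t `<=` D t] -> ulim C `<=` ulim D.
Proof. by move=> CD x Cx; apply: filterS2 CD Cx => t /= CD /CD. Qed.

Lemma ulim_congr C D : U [set t | C t = D t] -> ulim C = ulim D.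
Proof.
by move=> CD; apply/seteqP; split; apply: ulim_subset; apply: filterS CD => t /= ->.
Qed.

(** Boundedness is essential: a family of sets that moves away from the base point has
    an empty limit. *)
Lemma subset_ulim C D : bounded_family C -> ulim C `<=` ulim D -> U [set t | C t `<=` D t].
Proof.
move=> [n bndC] CD; apply: contrapT => /ultra_not notCD.
have [||x Cx] := @uval_choice (fun t => C t `\` D t).
- by apply: filterS notCD => t /= /existsNP[y /not_implyP]; exists y.
- by exists n; apply: filterS bndC => t /= bnd y [/bnd].
have : ulim D x by apply: CD; apply: filterS Cx => t /= [].
by move=> /(filterI Cx)/filter_ex[t [[]]].
Qed.

Lemma ulim_inj C D : bounded_family C -> bounded_family D -> ulim C = ulim D ->
  U [set t | C t = D t].
Proof.
move=> bndC bndD CD.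
have sCD : U [set t | C t `<=` D t] by apply: subset_ulim => //; rewrite CD.
have sDC : U [set t | D t `<=` C t] by apply: subset_ulim => //; rewrite CD.
by apply: filterS2 sCD sDC => t /= *; apply/seteqP.
Qed.

Lemma ulim_image (I : finType) (f : I -> uvert) (A : set I) :
  f @` A = ulim (fun t => (fun i => uval (f i) t) @` A).
Proof.
apply/seteqP; split=> [_ [i Ai <-]|x /= ex]; first by apply: filterS filterT => t _; exists i.
have [|i Ui] := @ultra_exists I (fun i t => A i /\ uval (f i) t = uval x t).
  by apply: filterS ex => t /= [i Ai e]; exists i.
have [t [Ai _]] := filter_ex Ui.
by exists i => //; apply: uvert_eq; apply: filterS Ui => t' /= [].
Qed.

Lemma ulim_seq (s : seq uvert) :
  [set x | x \in s] = ulim (fun t => [set y | y \in map (fun x => uval x t) s]).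
Proof.
apply/seteqP; split=> [x /= xs|x]; first by apply: filterS filterT => t _; exact: map_f.
rewrite /ulim /=; elim: s => [|y s IH] ex; first by have [t] := filter_ex ex.
have [|xy|] := @ultra_or [set t | uval x t = uval y t]
    [set t | uval x t \in map (fun x => uval x t) s].
- by apply: filterS ex => t /=; rewrite inE => /predU1P[]; [left|right].
- by rewrite (uvert_eq xy) mem_head.
- by move=> /IH xs; rewrite inE xs orbT.
Qed.

Lemma uval_cdist_bounded x y : exists n, U [set t | (cdist (uval x t) (uval y t) <= n)%N].
Proof.
have [n xn] := uval_tame x; have [m ym] := uval_tame y.
exists (n + m)%N; apply: filterS2 xn ym => t /= xn ym.
have := cdist_triangle (connQ (t := t)) (o t) (uval x t) (uval y t).
by rewrite (cdistC (connQ (t := t)) (uval x t) (o t)); lia.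
Qed.

Lemma bounded_seq (s : seq uvert) :
  bounded_family (fun t => [set y | y \in map (fun x => uval x t) s]).
Proof.
elim: s => [|x s [n bnd]]; first by exists 0%N; apply: filterS filterT.
have [m xm] := uval_tame x; exists (n + m)%N; apply: filterS2 bnd xm => t /= bnd xm y.
by rewrite inE => /predU1P[->|/bnd]; lia.
Qed.

Lemma bounded_near x n (C : forall t, set (Q t)) :
  U [set t | forall y, C t y -> (cdist (uval x t) y <= n)%N] -> bounded_family C.
Proof.
have [m xm] := uval_tame x; move=> bnd; exists (m + n)%N.
apply: filterS2 xm bnd => t /= xm bnd y /bnd.
by have := cdist_triangle (connQ (t := t)) (uval x t) (o t) y; lia.
Qed.

(** Nonemptiness excludes the families of cubes that move away from the base point. *)
Definition ucubes : set (set uvert) := [set C | C !=set0 /\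
  exists2 D : forall t, set (Q t), U [set t | cubes (D t)] & C = ulim D].

Lemma bounded_cubes (D : forall t, set (Q t)) :
  U [set t | cubes (D t)] -> ulim D !=set0 -> bounded_family D.
Proof.
move=> cD [x Dx]; apply: (@bounded_near x v); apply: filterS2 cD Dx => t /= cD Dx y Dy.
exact: (cube_cdist (connQ (t := t)) (dimQ (t := t)) cD Dx Dy).
Qed.

(** The dimensions of the cubes [D t] are bounded, hence almost always the same; so
    almost all charts together are one chart. *)
Lemma uchart_lift (D : forall t, set (Q t)) :
  U [set t | cubes (D t)] -> ulim D !=set0 ->
  exists n (phi : {ffun 'I_n -> bool} -> uvert), (n <= v)%N /\
    U [set t | cube_chart (@cubes (Q t)) (fun u => uval (phi u) t) (D t)].
Proof.
move=> cD D0; have [N bndD] := bounded_cubes cD D0.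
pose charted (n : nat) t :=
  exists phi : {ffun 'I_n -> bool} -> Q t, cube_chart (@cubes (Q t)) phi (D t).
have [n chn] : exists n : 'I_v.+1, U (charted n).
  apply: ultra_exists; apply: filterS cD => t /= cD.
  have [n [phi ch]] := cubes_chart cD.
  have lt_n : (n < v.+1)%N by rewrite ltnS; apply: (dimQ (C := D t)); split=> //; exists phi.
  by exists (Ordinal lt_n); exists phi.
pose psi t : {ffun 'I_n -> bool} -> Q t :=
  if pselect (charted n t) is left ex then projT1 (cid ex) else fun=> o t.
have ch_psi : U [set t | cube_chart (@cubes (Q t)) (psi t) (D t)].
  by apply: filterS chn => t /= ch; rewrite /psi; case: pselect => // ex; case: cid.
have /choice[phi phiE] : forall u, exists x, U [set t | uval x t = psi t u].
  move=> u; apply: uclass; exists N; apply: filterS2 bndD ch_psi => t /= bndD ch.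
  exact/bndD/(chart_mem ch).
exists n, phi; split; first by rewrite -ltnS.
have phiE' : U [set t | forall u, uval (phi u) t = psi t u] by apply: filter_forall.
by apply: filterS2 phiE' ch_psi => t /= /funext ->.
Qed.

(** The faces of a limit cube are limits of faces, since there are only finitely many
    faces to choose from. *)
Lemma uchart n (phi : {ffun 'I_n -> bool} -> uvert) (D : forall t, set (Q t)) :
  U [set t | cube_chart (@cubes (Q t)) (fun u => uval (phi u) t) (D t)] ->
  cube_chart ucubes phi (ulim D).
Proof.
move=> ch; split.
- move=> u u' e; have [t [phi_inj _ _]] := filter_ex ch.
  by apply: phi_inj; rewrite e.
- rewrite (ulim_image phi setT); apply: ulim_congr; apply: filterS ch => t [] //.
- move=> E sED; have faceE p : phi @` cube_face p =
      ulim (fun t => (fun u => uval (phi u) t) @` cube_face p) by exact: ulim_image.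
  split=> [[E0 [D' cD' eE]]|[p ->]]; last first.
    split.
      exists (phi [ffun i => odflt false (p i)]), [ffun i => odflt false (p i)] => //.
      by move=> i b pi; rewrite ffunE pi.
    exists (fun t => (fun u => uval (phi u) t) @` cube_face p); last exact: faceE.
    by apply: filterS ch => t /= ch; apply: chart_face ch p.
  have sD : U [set t | D' t `<=` D t].
    by apply: subset_ulim; rewrite -?eE //; apply: bounded_cubes; rewrite -?eE.
  have [p Up] : exists p : {ffun 'I_n -> option bool},
      U [set t | D' t = (fun u => uval (phi u) t) @` cube_face p].
    apply: ultra_exists; apply: filterS3 sD cD' ch => t /= sD cD' [_ _ facesP].
    by apply/(facesP _ sD).
  by exists p; rewrite eE faceE; apply: ulim_congr.
Qed.

Lemma ucubes_vertex x : ucubes [set x].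
Proof.
split; first by exists x.
exists (fun t => [set uval x t]).
  by apply: filterS filterT => t _; exact: cubes_vertex.
apply/seteqP; split=> [_ ->|y]; first by apply: filterS filterT.
by move=> yx; apply: uvert_eq.
Qed.

Lemma ucubes_chart C : ucubes C ->
  exists n (phi : {ffun 'I_n -> bool} -> uvert), cube_chart ucubes phi C.
Proof.
move=> [C0 [D cD eC]]; rewrite eC in C0 *.
by have [n [phi [_ ch]]] := uchart_lift cD C0; exists n, phi; exact: uchart.
Qed.

Lemma ucubes_inter C C' : ucubes C -> ucubes C' -> C `&` C' !=set0 ->
  ucubes (C `&` C').
Proof.
move=> [_ [D cD ->]] [_ [D' cD' ->]] [x [Dx D'x]]; split; first by exists x.
exists (fun t => D t `&` D' t).
  apply: filterS2 (filterI cD cD') (filterI Dx D'x) => t /= [cD0 cD0'] DD'.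
  by apply: cubes_inter => //; exists (uval x t).
apply/seteqP; split=> y; first by move=> [Dy D'y]; apply: filterI.
by move=> DD'y; split; apply: filterS DD'y => t [].
Qed.

Definition ultraproduct : cube_complex :=
  CubeComplex ucubes_vertex ucubes_chart ucubes_inter.

Notation V := ultraproduct.
Implicit Types (x y z w : V).

Lemma ultraproduct_dim : dim_le V v.
Proof.
move=> n C [[C0 [D cD eC]] [psi [psi_inj rpsi _]]]; rewrite eC in C0 rpsi.
have [m [phi [le_m /uchart[phi_inj rphi _]]]] := uchart_lift cD C0.
apply: leq_trans le_m.
have /choice[g gE] : forall u, exists u', phi u' = psi u.
  move=> u; have [u' _ e] : range phi (psi u) by rewrite rphi -rpsi; exists u.
  by exists u'.
have g_inj : injective g by move=> u u' e; apply: psi_inj; rewrite -!gE e.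
by have := leq_card g g_inj; rewrite !card_ffun !card_bool !card_ord leq_exp2l.
Qed.

Lemma ucubes_seq (s : seq V) : s != [::] ->
  cubes [set x | x \in s] <-> U [set t | cubes [set y | y \in map (fun x => uval x t) s]].
Proof.
case: s => // x s _; set S := x :: s; have ne : [set x | x \in S] !=set0.
  by exists x; rewrite /= inE eqxx.
have ulimS := ulim_seq S.
split=> [[_ [D cD eD]]|cS]; last by split=> //; exists (fun t => [set y | y \in map (fun x => uval x t) S]).
have bD : bounded_family D by apply: bounded_cubes; rewrite -?eD.
rewrite eD in ulimS.
by apply: filterS2 (ulim_inj bD (bounded_seq S) ulimS) cD => t /= ->.
Qed.

Lemma set2_seq (T : eqType) (x y : T) : [set x; y] = [set z | z \in [:: x; y]].
Proof.
apply/seteqP; split=> z /=; first by case=> ->; rewrite !inE eqxx ?orbT.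
by rewrite !inE => /orP[] /eqP ->; [left|right].
Qed.

Lemma uadj x y : adj x y <-> U [set t | adj (uval x t) (uval y t)].
Proof.
split=> [/adjP[xy]|xy].
  rewrite set2_seq => /ucubes_seq /= /(_ isT) cxy.
  have nxy : U [set t | uval x t <> uval y t].
    by apply: ultra_not => /uvert_eq/xy.
  by apply: filterS2 nxy cxy => t /= ne cub; apply/adjP; rewrite set2_seq.
apply/adjP; split.
  by move=> e; have [t] := filter_ex xy; rewrite /= e adj_irr.
rewrite set2_seq; apply/ucubes_seq => //; apply: filterS xy => t /= /adjP[_].
by rewrite set2_seq.
Qed.

Lemma usquare x y z w :
  U [set t | square (uval x t) (uval y t) (uval z t) (uval w t)] -> square x y z w.
Proof.
move=> sq; split.
- by apply/ucubes_seq => //; apply: filterS sq => t [].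
- have [t [_ uni _]] := filter_ex sq.
  exact: (@map_uniq _ _ (fun x : V => uval x t) [:: x; y; z; w]).
- by apply/and5P; split=> //; apply/uadj; apply: filterS sq => t [_ _ /= /and5P[]].
Qed.

Lemma upath n x y : path_of_length x y n <->
  U [set t | path_of_length (uval x t) (uval y t) n].
Proof.
split=> [[s [ps ls <-]]|].
  elim: s x ps ls => [|z s IH] x /=.
    by move=> _ ->; apply: filterS filterT => t _; exists [::].
  move=> /andP[/uadj xz ps] ls; apply: filterS2 xz (IH _ ps ls) => t /= xz [s' [ps' ls' ss']].
  by exists (uval z t :: s'); rewrite /= xz ps' ss'.
elim: n x => [|n IHn] x path_xy.
  suff -> : x = y by exists [::].
  by apply: uvert_eq; apply: filterS path_xy => t [[|? ?] []].
have [||z] := @uval_choice (fun t => [set z | adj (uval x t) z /\ path_of_length z (uval y t) n]).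
- apply: filterS path_xy => t [[|z s] [] //= /andP[xz ps] ls [ss]].
  by exists z; split=> //; exists s.
- apply: (@bounded_near x 1%N); apply: filterS filterT => t _ z [xz _].
  exact: cdist_adj_le.
move=> h; have /uadj xz : U [set t | adj (uval x t) (uval z t)].
  by apply: filterS h => t [].
have [|s [ps ls ss]] := IHn z; first by apply: filterS h => t [].
by exists (z :: s); rewrite /= xz ps ss.
Qed.

Lemma ultraproduct_connected : connected_complex V.
Proof.
move=> x y; have [n bnd] := uval_cdist_bounded x y.
have [m em] := ultra_bounded bnd.
have [s [ps ls _]] : path_of_length x y m; last by exists s.
by apply/upath; apply: filterS em => t /= <-; apply: cdist_path.
Qed.

Lemma ultraproduct_cdist x y : U [set t | cdist (uval x t) (uval y t) = cdist x y].
Proof.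
have [n bnd] := uval_cdist_bounded x y; have [m em] := ultra_bounded bnd.
have le_m : (cdist x y <= m)%N.
  apply: cdist_min; apply/upath; apply: filterS em => t /= <-; exact: cdist_path.
have /upath ge := cdist_path ultraproduct_connected x y.
by apply: filterS2 em ge => t /= em /cdist_min; lia.
Qed.

(** The distance from a vertex is a rank function to which [rank_contraction] applies,
    as the quadrangle condition passes to the limit. *)
Lemma ultraproduct_simply_connected : simply_connected V.
Proof.
split; first exact: ultraproduct_connected.
move=> x s ps ls; apply: (rank_contraction (rk := cdist x)) => //.
- exact: cdist_xx.
- move=> y z /uadj yz.
  have [t [/= yz_t [<- <-]]] :=
    filter_ex (filterI yz (filterI (ultraproduct_cdist x y) (ultraproduct_cdist x z))).
  exact: (cdist_adj (catQ t)).
- move=> y z z' yz yz' zz' dz dz'.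
  have zz't : U [set t | uval z t <> uval z' t].
    by apply: ultra_not => /uvert_eq/eqP; rewrite (negPf zz').
  pose P t := [set w | square (uval y t) (uval z t) w (uval z' t) /\
    cdist (uval x t) (uval z t) = (cdist (uval x t) w).+1].
  have [||w Pw] := @uval_choice P.
  + have dd : U [set t | cdist (uval x t) (uval z t) = cdist x z /\
        cdist (uval x t) (uval z' t) = cdist x z'].
      exact: filterI (ultraproduct_cdist x z) (ultraproduct_cdist x z').
    have dy : U [set t | cdist (uval x t) (uval y t) = cdist x y /\ uval z t <> uval z' t].
      exact: filterI (ultraproduct_cdist x y) zz't.
    have adjs : U [set t | adj (uval y t) (uval z t) /\ adj (uval y t) (uval z' t)].
      by move: yz yz' => /uadj yz /uadj yz'; apply: filterI.
    apply: filterS3 adjs dd dy => t /= [yz_t yz't] [ez ez'] [ey ne].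
    have [||w sq dw] := quadrangle (catQ t) yz_t yz't (introN eqP ne) _ (erefl (cdist (uval x t) (uval z t))) _.
    + by rewrite ey ez.
    + by rewrite ez' ez; lia.
    + by exists w.
  + apply: (@bounded_near z 1%N); apply: filterS filterT => t _ w [sq _].
    by have [_ zw _ _] := square_adj sq; apply: cdist_adj_le.
  exists w; first by apply: usquare; apply: filterS Pw => t [].
  have [t [/= [_] + [<- <-]]] :=
    filter_ex (filterI Pw (filterI (ultraproduct_cdist x z) (ultraproduct_cdist x w))).
  by [].
Qed.

(** For a finite set of neighbours of [x] both the hypothesis and the conclusion speak
    of finitely many internal sets. *)
Lemma ultraproduct_flag : flag_links V.
Proof.
move=> x S /finite_seqP[s ->] adj_xs link_s.
have adj_s : U [set t | forall y, y \in s -> adj (uval x t) (uval y t)].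
  by apply: ultra_seq => y ys; apply/uadj/adj_xs.
pose nbs (D : forall t, set (Q t)) t := [set w | D t w /\ adj (uval x t) w].
have nbsE D : ulim (nbs D) = [set w | ulim D w /\ adj x w].
  apply/seteqP; split=> w.
    move=> h; split; first by apply: filterS h => t [].
    by apply/uadj; apply: filterS h => t [].
  by move=> [Dw /uadj xw]; apply: filterI.
have bnd_nbs D : bounded_family (nbs D).
  apply: (@bounded_near x 1%N); apply: filterS filterT => t _ w [_].
  exact: cdist_adj_le.
have links : U [set t | forall y, y \in s -> forall z, z \in s ->
    link_simplex (uval x t) [set uval y t; uval z t]].
  apply: ultra_seq => y ys; apply: ultra_seq => z zs.
  have [C [[_ [D cD eC]] Cx E]] := link_s y z ys zs; rewrite eC in Cx E.
  have e : U [set t | [set w | w \in map (fun x => uval x t) [:: y; z]] = nbs D t].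
    apply: ulim_inj (bounded_seq _) (bnd_nbs D) _.
    by rewrite -ulim_seq nbsE -E set2_seq.
  apply: filterS3 cD Cx e => t /= cD Cx e; exists (D t); split=> //.
  by rewrite set2_seq e.
pose link_t t D := [/\ cubes D, D (uval x t)
  & [set y | y \in map (fun x => uval x t) s] = [set y | D y /\ adj (uval x t) y]].
have link_all : U [set t | exists D, link_t t D].
  apply: filterS2 adj_s links => t /= adj_s links.
  apply: (catQ t).2.
  - exact: finite_seq.
  - by move=> _ /= /mapP[y ys ->]; apply: adj_s.
  - by move=> _ _ /= /mapP[y ys ->] /mapP[z zs ->]; apply: links.
pose D t : set (Q t) := xget set0 (link_t t).
have linkD : U [set t | link_t t (D t)] by apply: filterS link_all => t ex; exact: (xgetPex set0 ex).
have Dx : ulim D x by apply: filterS linkD => t [].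
exists (ulim D); split=> //.
  by split; [exists x | exists D => //; apply: filterS linkD => t []].
rewrite -nbsE; apply: (eq_trans (ulim_seq s)); apply: ulim_congr.
by apply: filterS linkD => t [].
Qed.

Lemma ultraproduct_CAT0 : CAT0 V.
Proof. by split; [exact: ultraproduct_simply_connected | exact: ultraproduct_flag]. Qed.

Lemma ultraproduct_cmed x y z :
  U [set t | uval (cmed x y z) t = cmed (uval x t) (uval y t) (uval z t)].
Proof.
have [m1 m2 m3] := cmedP ultraproduct_CAT0 x y z.
have transfer (a b c : V) : between a b c -> U [set t | between (uval a t) (uval b t) (uval c t)].
  rewrite /between => abc.
  apply: filterS3 (ultraproduct_cdist a b) (ultraproduct_cdist b c) (ultraproduct_cdist a c).
  by move=> t /= -> -> ->.
apply: filterS3 (transfer _ _ _ m1) (transfer _ _ _ m2) (transfer _ _ _ m3) => t /= p1 p2 p3.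
by apply/esym/(cmed_uniq (catQ t)).
Qed.

End Ultraproduct.

(** * Coarse hulls *)

Section FiniteSets.

Lemma seq_card_le (T : eqType) (s : seq T) N : (size s <= N)%N -> [set x | x \in s] #<= `I_N.
Proof.
case: s => [_|x0 s le_N].
  by rewrite (_ : [set x | x \in [::]] = set0) ?card_ge0 //; apply/seteqP; split=> x.
have -> : [set x | x \in x0 :: s] = nth x0 (x0 :: s) @` `I_(size (x0 :: s)).
  apply/seteqP; split=> [x xs|_ [i lt_i <-]]; last exact: mem_nth.
  by exists (index x (x0 :: s)); [move: xs; rewrite /mkset -index_mem | exact: nth_index].
by apply: card_le_trans (card_image_le _ _) _; rewrite card_le_II.
Qed.

Lemma card_eq_range T (A : set T) n : A #= `I_n -> exists g : 'I_n -> T, A = range g.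
Proof.
move=> /card_set_bijP[f [fA f_inj f_surj]].
have /choice[g gP] : forall i : 'I_n, exists x, A x /\ f x = i.
  by move=> i; have [|x Ax fx] := f_surj i; [exact: (ltn_ord i) | exists x].
exists g; apply/seteqP; split=> [x Ax|_ [i _ <-]]; last by have [] := gP i.
have lt_x := fA x Ax; exists (Ordinal lt_x) => //.
have [Ag fg] := gP (Ordinal lt_x).
by apply: f_inj; rewrite ?inE.
Qed.

Lemma range_card (I : finType) (T : choiceType) (g : I -> T) :
  exists2 n, (n <= #|I|)%N & range g #= `I_n.
Proof.
have gE : range g = [set x | x \in map g (enum I)].
  apply/seteqP; split=> [_ [i _ <-]|x /= /mapP[i _ ->]]; last by exists i.
  by rewrite /= map_f // mem_enum.
have le_I : range g #<= `I_#|I|.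
  by rewrite gE; apply: seq_card_le; rewrite size_map -cardE.
have [n gn] : finite_set (range g) by apply/finite_set_leP; exists #|I|.
by exists n => //; rewrite -card_le_II -(card_le_eql gn).
Qed.

End FiniteSets.

Section Joins.
Variables (T : Type) (m : T -> T -> T -> T).

Lemma iter_join_subset n (A B : set T) : A `<=` B ->
  iter n (median_join m) A `<=` iter n (median_join m) B.
Proof.
move=> AB; elim: n => //= n IHn x [a /IHn Ja [b /IHn Jb abx]].
by exists a => //; exists b.
Qed.

Lemma iter_join_directed n (A : nat -> set T) x :
  (forall s t, (s <= t)%N -> A s `<=` A t) ->
  iter n (median_join m) (\bigcup_t A t) x -> exists t, iter n (median_join m) (A t) x.
Proof.
move=> monoA; elim: n x => [|n IHn] x /=; first by move=> [t _ Ax]; exists t.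
move=> [a /IHn[s Ja] [b /IHn[t Jb] abx]]; exists (maxn s t).
exists a; first by apply: iter_join_subset Ja; apply: monoA; rewrite leq_maxl.
by exists b => //; apply: iter_join_subset Jb; apply: monoA; rewrite leq_maxr.
Qed.

Lemma iter_join_nonempty n (A : set T) : A !=set0 -> iter n (median_join m) A !=set0.
Proof.
move=> A0; elim: n => //= n [x Jx].
by exists (m x x x); exists x => //; exists x => //; exists x.
Qed.

End Joins.

Lemma mdist_triangle (R : realType) (X : metricType R) (y x z : X) :
  mdist x z <= mdist x y + mdist y z.
Proof. exact: metric_triangle. Qed.

Section CoarseHull.
Variables (R : realType) (X : metricType R) (m : X -> X -> X -> X) (r : nat).
Variables (h : nat -> nat).
Notation L := ((h 1%N)%:R : R).
Notation J := (median_join m).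
Implicit Types (x y z a b : X) (A B : set X).

Hypothesis lip_m : forall x y z x' y' z', mdist (m x y z) (m x' y' z') <=
  L * (mdist x x' + mdist y y' + mdist z z').

Hypothesis approx_m : forall (n : nat) A, A #<= `I_n ->
  exists Q : cube_complex, [/\ CAT0 Q, finite_complex Q, dim_le Q r &
    exists (f : Q -> X) (g : A -> Q),
      median_map (@cmed Q) (@mdist R X) m (h n)%:R f /\
      forall a : A, mdist (val a) (f (g a)) <= (h n)%:R].

Lemma lip_bound x y z x' y' z' (a b c : R) : mdist x x' <= a -> mdist y y' <= b ->
  mdist z z' <= c -> mdist (m x y z) (m x' y' z') <= L * (a + b + c).
Proof.
move=> xa yb zc; apply: le_trans (lip_m _ _ _ _ _ _) _.
by apply: ler_wpM2l; rewrite ?ler0n ?lerD.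
Qed.

Lemma approx_seq (s : seq X) N : (size s <= N)%N -> s != [::] ->
  exists Q : cube_complex, [/\ CAT0 Q, dim_le Q r &
    exists (f : Q -> X) (g : X -> Q),
      median_map (@cmed Q) (@mdist R X) m (h N)%:R f /\
      forall a, a \in s -> mdist a (f (g a)) <= (h N)%:R].
Proof.
move=> le_N; case: s le_N => // a0 s le_N _.
have [Q [catQ _ dimQ [f [g [fm fg]]]]] := approx_m (seq_card_le le_N).
exists Q; split=> //; exists f.
have a0P : a0 \in [set x | x \in a0 :: s] by rewrite inE /= mem_head.
pose g' a := if pselect (a \in [set x | x \in a0 :: s]) is left aP
  then g (exist _ a aP) else g (exist _ a0 a0P).
exists g'; split=> // a a_s; rewrite /g'; case: pselect => [aP|]; first exact: (fg (exist _ a aP)).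
by rewrite inE.
Qed.

Lemma coarse_idempotent : exists2 c : R, 0 <= c & forall a, mdist a (m a a a) <= c.
Proof.
exists ((h 1%N)%:R + ((h 1%N)%:R + L * ((h 1%N)%:R + (h 1%N)%:R + (h 1%N)%:R))).
  by rewrite !addr_ge0 // mulr_ge0 // !addr_ge0.
move=> a; have [|//|Q [catQ _ [f [g [fm fg]]]]] := @approx_seq [:: a] 1%N; first by [].
have d := fg a (mem_head _ _).
apply: le_trans (mdist_triangle (f (g a)) _ _) _; apply: lerD => //.
have := fm (g a) (g a) (g a); rewrite (cmed_xxz catQ) => fgm.
apply: le_trans (mdist_triangle (m (f (g a)) (f (g a)) (f (g a))) _ _) _.
by apply: lerD => //; apply: lip_bound; rewrite metric_sym.
Qed.

(** A join need not contain the set it is formed from, as [m a a a] is only near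
    [a]. *)
Lemma iter_join_near_self n : exists2 c : R, 0 <= c &
  forall A a, A a -> exists2 b, iter n J A b & mdist a b <= c.
Proof.
have [c c_ge0 idem] := coarse_idempotent.
elim: n => [|n [c' c'_ge0 IHn]]; first by exists 0 => // A a Aa; exists a; rewrite ?mdistxx.
exists (c + L * (c' + c' + c')) => [|A a Aa].
  by rewrite addr_ge0 // mulr_ge0 // !addr_ge0.
have [b Jb ab] := IHn A a Aa; exists (m b b b).
  by exists b => //; exists b => //; exists b.
apply: le_trans (mdist_triangle (m a a a) _ _) _.
by apply: lerD => //; apply: lip_bound.
Qed.

Lemma iter_join_near n e : 0 <= e -> exists2 c : R, 0 <= c &
  forall A B, (forall a, A a -> exists2 b, B b & mdist a b <= e) ->
  forall x, iter n J A x -> exists2 y, iter n J B y & mdist x y <= c.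
Proof.
move=> e_ge0; elim: n => [|n [c c_ge0 IHn]]; first by exists e.
exists (L * (c + c + 0)) => [|A B AB x /= [a Ja [b Jb [z _ <-]]]].
  by rewrite mulr_ge0 // !addr_ge0.
have [a' Ja' aa'] := IHn A B AB a Ja; have [b' Jb' bb'] := IHn A B AB b Jb.
exists (m a' b' z); first by exists a' => //; exists b' => //; exists z.
by apply: lip_bound; rewrite ?mdistxx.
Qed.

(** A point of an iterated join is a median expression in boundedly many points, and
    may be evaluated in any complex that approximates these points. *)
Lemma iter_join_approx n (d : R) : 0 <= d -> exists2 c : R, 0 <= c &
  forall A x, iter n J A x -> exists s : seq X, [/\ (size s <= 4 ^ n)%N, s != [::] &
    forall (Q : cube_complex) (f : Q -> X) (g : X -> Q),
      median_map (@cmed Q) (@mdist R X) m d f ->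
      (forall a, a \in s -> mdist a (f (g a)) <= d) ->
      exists2 q, iter n (median_join (@cmed Q)) (g @` (A `&` [set a | a \in s])) q
        & mdist x (f q) <= c].
Proof.
move=> d_ge0; elim: n => [|n [c c_ge0 IHn]].
  exists d => // A x Ax; exists [:: x]; split=> // Q f g fm fg.
  by exists (g x); [exists x => //; split=> //; rewrite /= inE | apply: fg; rewrite inE].
exists (L * (c + c + d) + d) => [|A x /= [a Ja [b Jb [z _ <-]]]].
  by rewrite addr_ge0 // mulr_ge0 // !addr_ge0.
have [sa [size_a _ evala]] := IHn A a Ja; have [sb [size_b _ evalb]] := IHn A b Jb.
exists (z :: sa ++ sb); split=> //.
  have := expn_gt0 4 n; rewrite /= size_cat expnS.
  by move: size_a size_b => /=; lia.
move=> Q f g fm fg.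
have [|qa Jqa da] := evala Q f g fm.
  by move=> y ys; apply: fg; rewrite inE mem_cat ys orbT.
have [|qb Jqb db] := evalb Q f g fm.
  by move=> y ys; apply: fg; rewrite inE mem_cat ys !orbT.
exists (cmed qa qb (g z)).
  exists qa; first apply: iter_join_subset Jqa.
    by move=> _ [y [Ay ys] <-]; exists y => //; split=> //; rewrite /= inE mem_cat ys orbT.
  exists qb; first apply: iter_join_subset Jqb.
    by move=> _ [y [Ay ys] <-]; exists y => //; split=> //; rewrite /= inE mem_cat ys !orbT.
  by exists (g z).
apply: le_trans (mdist_triangle (m (f qa) (f qb) (f (g z))) _ _) _.
apply: lerD; last by rewrite metric_sym; apply: fm.
by apply: lip_bound => //; apply: fg; rewrite mem_head.
Qed.

(** The medians that reach a point of the hull in [hull_reached] can be imitated in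
    [X] up to bounded error, and there [n] of them stay within [n] joins. *)
Lemma foldl_join n (d : R) : 0 <= d -> exists2 c : R, 0 <= c &
  forall A (Q : cube_complex) (f : Q -> X) (q p : Q) (bs : seq Q), size bs = n ->
    median_map (@cmed Q) (@mdist R X) m d f ->
    (forall b : Q, b \in p :: bs -> exists2 a, A a & mdist a (f b) <= d) ->
    exists2 y, iter n J A y & mdist y (f (foldl (fun p e => cmed p e q) p bs)) <= c.
Proof.
move=> d_ge0; elim: n => [|n [c c_ge0 IHn]].
  exists d => // A Q f q p bs /size0nil -> fm near_A.
  by have [|a Aa da] := near_A p; [rewrite inE | exists a].
have [c' c'_ge0 self] := iter_join_near_self n.
exists (L * (c + (c' + d) + 0) + d) => [|A Q f q p bs].
  by rewrite addr_ge0 // mulr_ge0 // !addr_ge0.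
case/lastP: bs => // bs b; rewrite size_rcons => -[size_bs] fm near_A.
have [|y Jy dy] := IHn A Q f q p bs size_bs fm.
  move=> b' b's; apply: near_A; move: b's; rewrite !inE mem_rcons inE.
  by case/orP => ->; rewrite ?orbT.
have [|a Aa da] := near_A b; first by rewrite inE mem_rcons mem_head orbT.
have [a' Ja' da'] := self A a Aa.
exists (m y a' (f q)); first by exists y => //; exists a' => //; exists (f q).
rewrite foldl_rcons.
apply: le_trans (mdist_triangle (m (f (foldl (fun p e => cmed p e q) p bs)) (f b) (f q)) _ _) _.
apply: lerD; last by rewrite metric_sym; apply: fm.
apply: lip_bound; rewrite ?mdistxx //.
by apply: le_trans (mdist_triangle a _ _) _; apply: lerD => //; rewrite metric_sym.
Qed.

(** Evaluate the point in an approximating complex, replace the expression by one with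
    [r] joins there, and evaluate this in [X] again. *)
Lemma iter_join_near_hull n : exists2 c : R, 0 <= c &
  forall A x, iter n J A x -> exists2 y, median_hull m r A y & mdist x y <= c.
Proof.
set d : R := (h (4 ^ n))%:R; have d_ge0 : 0 <= d by [].
have [c c_ge0 eval] := iter_join_approx n d_ge0.
have [c' c'_ge0 fold] := foldl_join r d_ge0.
exists (c + c') => [|A x Jx]; first exact: addr_ge0.
have [s [size_s s0 eval_s]] := eval A x Jx.
have [Q [catQ dimQ [f [g [fm fg]]]]] := approx_seq size_s s0.
have [q Jq dq] := eval_s Q f g fm fg.
have [a [bs [Aa Abs size_bs eq_q]]] := hull_reached catQ dimQ Jq.
have near (e : Q) : (g @` (A `&` [set a | a \in s])) e -> exists2 a, A a & mdist a (f e) <= d.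
  by move=> [a' [Aa' sa'] <-]; exists a' => //; apply: fg.
have [|y Jy dy] := fold A Q f q a bs size_bs fm.
  by move=> e; rewrite inE => /predU1P[->|/Abs]; apply: near.
exists y => //; apply: le_trans (mdist_triangle (f q) _ _) _.
by apply: lerD => //; rewrite metric_sym -[q in f q]eq_q.
Qed.

Section Rays.
Variables (l : R) (l_gt0 : 0 < l).

Definition truncation (F : set X) (Y : set ({nonneg R} -> X)) (t : nat) : set X :=
  F `|` [set u 0%:nng | u in Y] `|` [set u t%:R%:nng | u in Y].

Lemma med3_middle (t s : {nonneg R}) : s <= t -> med3 0%:nng t s = s.
Proof.
move=> st; have ge0 (u : {nonneg R}) : 0%:nng <= u by rewrite -num_le /= ge0.
by rewrite /med3 (min_l (ge0 t)) (max_r (ge0 t)) (min_r st) (max_r (ge0 s)).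
Qed.

(** A point [x] of the hull involves the rays only up to some time [T].  For [t] past
    [T] these parts of the rays lie near the join of the truncation, because
    [u s] is near the median of [u 0], [u t] and [u s]; so [x] is near the
    [r.+1]-fold join of the truncation, hence near its hull. *)
Lemma hull_exhausted : exists2 c : R, 0 <= c &
  forall F Y, (forall u, Y u -> median_ray m l u) ->
  forall x, median_hull m r (F `|` \bigcup_(u in Y) range u) x ->
  exists T, forall t, (T <= t)%N ->
    exists2 y, median_hull m r (truncation F Y t) y & mdist x y <= c.
Proof.
have [c1 c1_ge0 idem] := coarse_idempotent.
have [c2 c2_ge0 near] := iter_join_near r (addr_ge0 c1_ge0 (ltW l_gt0)).
have [c3 c3_ge0 hull] := iter_join_near_hull r.+1.
exists (c2 + c3) => [|F Y rays x]; first exact: addr_ge0.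
pose A t := F `|` [set u s | u in Y & s in [set s : {nonneg R} | s%:num <= t%:R]].
have monoA s t : (s <= t)%N -> A s `<=` A t.
  move=> st y [Fy|[u Yu [w ws <-]]]; [by left|right].
  by exists u => //; exists w => //; rewrite /= (le_trans ws) // ler_nat.
have -> : F `|` \bigcup_(u in Y) range u = \bigcup_t A t.
  apply/seteqP; split=> y.
    case=> [Fy|[u Yu [w _ <-]]]; first by exists 0%N => //; left.
    exists (Num.bound w%:num) => //; right; exists u => //; exists w => //=.
    by apply/ltW/archi_boundP.
  move=> [t _ [Fy|[u Yu [w _ <-]]]]; [by left|by right; exists u => //; exists w].
move=> /(iter_join_directed monoA)[T JT]; exists T => t Tt.
have [||y Jy dy] := near (A t) (J (truncation F Y t)) _ x.
- move=> a [Fa|[u Yu [w wt <-]]].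
    exists (m a a a); last by rewrite (le_trans (idem a)) // lerDl ltW.
    by exists a; [left; left|exists a; [left; left|exists a]].
  exists (m (u 0%:nng) (u t%:R%:nng) (u w)).
    exists (u 0%:nng); first by left; right; exists u.
    by exists (u t%:R%:nng); [right; exists u|exists (u w)].
  have [_ /(_ 0%:nng t%:R%:nng w)] := rays u Yu.
  rewrite med3_middle; last by rewrite -num_le.
  by move=> le_l; rewrite (le_trans le_l) // lerDr.
- by apply: iter_join_subset JT; apply: monoA.
have [z Hz dz] : exists2 y', median_hull m r (truncation F Y t) y' & mdist y y' <= c3.
  by apply: hull; rewrite iterSr.
by exists z => //; apply: le_trans (mdist_triangle y _ _) _; apply: lerD.
Qed.

End Rays.
End CoarseHull.

(** * Limits of approximating complexes *)

Section LimitComplex.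
Variables (R : realType) (X : metricType R) (m : X -> X -> X -> X) (L : R).
Hypothesis proper_X : proper_space X.
Hypothesis L_ge0 : 0 <= L.
Hypothesis lip_m : forall x y z x' y' z', mdist (m x y z) (m x' y' z') <=
  L * (mdist x x' + mdist y y' + mdist z z').

(** Both terms are near a cluster point. *)
Lemma bounded_ultra (U : set_system nat) (u : nat -> X) x0 B G : UltraFilter U ->
  U [set t | mdist x0 (u t) <= B] -> U G ->
  exists2 s, G s & U [set t | mdist (u s) (u t) <= 2].
Proof.
move=> UU bnd UG.
have [y [_ cl_y]] := proper_X (fmap_proper_filter u (@ultra_proper _ U UU)) bnd.
have near_y : U [set t | mdist y (u t) < 1].
  case: (in_ultra_setVsetC [set t | mdist y (u t) < 1] UU) => // far.
  have [|z [/=]] := cl_y (~` [set z | mdist y z < 1]) (ball y 1) far.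
    exact: nbhsx_ballx.
  by rewrite ballEmdist.
have [s [Gs ys]] := filter_ex (filterI UG near_y).
exists s => //; apply: filterS near_y => t /= yt.
by have := mdist_triangle y (u s) (u t); rewrite (metric_sym (u s) y) /=; move: ys => /=; lra.
Qed.

Variables (H : set X) (x0 : X) (Q : nat -> cube_complex) (v : nat).
Variables (f : forall t, Q t -> X) (K E : R).
Variables (o : forall t, Q t) (U : set_system nat).
Hypothesis UU : UltraFilter U.
Hypothesis Hx0 : H x0.
Hypothesis K_ge0 : 0 <= K.
Hypothesis E_ge0 : 0 <= E.
Hypothesis catQ : forall t, CAT0 (Q t).
Hypothesis dimQ : forall t, dim_le (Q t) v.
Hypothesis fH : forall t q, H (@f t q).
Hypothesis f_upper : forall t (p q : Q t),
  mdist (f p) (f q) <= K * vdist R p q + K.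
Hypothesis f_lower : forall t (p q : Q t),
  vdist R p q <= K * (mdist (f p) (f q) + K).
Hypothesis f_median : forall t, median_map (@cmed (Q t)) (@mdist R X) m K (@f t).
Hypothesis f_dense : forall x, H x -> U [set t | exists q : Q t, mdist x (f q) <= E].

Definition lift x t : Q t := xget (o t) [set q | mdist x (f q) <= E].

Lemma liftP x : H x -> U [set t | mdist x (f (lift x t)) <= E].
Proof. by move=> /f_dense; apply: filterS => t ex; exact: (xgetPex (o t) ex). Qed.

Notation base := (lift x0).
Notation V := (ultraproduct base UU catQ dimQ).

Lemma bounded_tame (s : forall t, Q t) (B : R) :
  U [set t | mdist x0 (f (s t)) <= B] -> tame base U s.
Proof.
move=> bnd; exists (Num.bound (K * (E + `|B| + K))).
apply: filterS2 bnd (liftP Hx0) => t /= bnd near_x0.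
rewrite -(ler_nat R); apply: ltW; apply: le_lt_trans (archi_boundP _).
  apply: le_trans (f_lower _ _) _; apply: ler_wpM2l => //; apply: lerD => //.
  apply: le_trans (mdist_triangle x0 _ _) _; rewrite metric_sym; apply: lerD => //.
  by rewrite (le_trans bnd) // ler_norm.
by rewrite mulr_ge0 // !addr_ge0.
Qed.

Lemma lift_tame x : H x -> tame base U (lift x).
Proof.
move=> /liftP near_x; apply: (@bounded_tame _ (mdist x0 x + E)).
apply: filterS near_x => t /= near_x.
by apply: le_trans (mdist_triangle x _ _) _; rewrite lerD2l.
Qed.

(** The sum of the bounds that the estimates below require. *)
Definition limit_constant : R := 1 + K + (2 * E + K) + K * (2 * E + K)
  + K * (E + 2 + K) + (L * (E + E + E) + K)
  + K * ((E + (L * (E + E + E) + K) + L * (E + E + E) + K) + K).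

Notation median_error := (L * (E + E + E) + K).

Lemma limit_constant_bounds :
  [/\ 1 <= limit_constant, K <= limit_constant, 2 * E + K <= limit_constant,
      K * (2 * E + K) <= limit_constant &
      [/\ K * (E + 2 + K) <= limit_constant, median_error <= limit_constant &
      K * ((E + median_error + L * (E + E + E) + K) + K) <= limit_constant]].
Proof.
have LE_ge0 : 0 <= L * (E + E + E) by rewrite mulr_ge0 // !addr_ge0.
have b1 : 0 <= K * (2 * E + K) by rewrite mulr_ge0 // addr_ge0 // mulr_ge0.
have b2 : 0 <= K * (E + 2 + K) by rewrite mulr_ge0 // !addr_ge0.
have b3 : 0 <= K * ((E + median_error + L * (E + E + E) + K) + K).
  by rewrite mulr_ge0 // !addr_ge0.
move: K_ge0 E_ge0 LE_ge0 b1 b2 b3; rewrite /limit_constant.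
move: (K * ((E + median_error + L * (E + E + E) + K) + K)) => p1.
move: (K * (2 * E + K)) (K * (E + 2 + K)) (L * (E + E + E)) => p2 p3 p4.
by move=> *; split; [| | | | split]; lra.
Qed.

(** A vertex [w] of the ultraproduct is near the image of a point [f (uval w s)], for one
    index [s] such that the images of almost all terms of [w] are near this
    point. *)
Lemma exists_limit_complex : exists Q : cube_complex, [/\ CAT0 Q, dim_le Q v &
  exists (mu : H -> H -> H -> H) (phi : H -> Q),
    [/\ induced_median m limit_constant mu,
        quasi_isometry (@sub_dist R X H) (@vdist R Q) limit_constant phi &
        median_map mu (@vdist R Q) (@cmed Q) limit_constant phi]].
Proof.
exists V; split; [exact: ultraproduct_CAT0 | exact: ultraproduct_dim|].
set l := limit_constant.
set C := L * (E + E + E) + K.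
have [l_ge1 Kl EKl KEKl [KE2l Cl Kl3]] := limit_constant_bounds.
rewrite -/l -/C in l_ge1 Kl EKl KEKl KE2l Cl Kl3.
have HP (x : H) : H (val x) by apply: set_valP.
have lip x y z x' y' z' : mdist x x' <= E -> mdist y y' <= E -> mdist z z' <= E ->
    mdist (m x y z) (m x' y' z') <= L * (E + E + E).
  move=> xE yE zE; apply: le_trans (lip_m _ _ _ _ _ _) _.
  by apply: ler_wpM2l => //; rewrite !lerD.
have median_near (x y z : H) : U [set t | mdist (f (cmed (lift (val x) t) (lift (val y) t)
    (lift (val z) t))) (m (val x) (val y) (val z)) <= C].
  apply: filterS3 (liftP (HP x)) (liftP (HP y)) (liftP (HP z)) => t /= dx dy dz.
  apply: le_trans (mdist_triangle (m (f (lift (val x) t)) (f (lift (val y) t))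
    (f (lift (val z) t))) _ _) _.
  by rewrite /C [leRHS]addrC; apply: lerD; [apply: f_median | apply: lip; rewrite metric_sym].
have /choice[mu3 mu3P] : forall xyz : H * H * H, exists w : H,
    mdist (val w) (m (val xyz.1.1) (val xyz.1.2) (val xyz.2)) <= C.
  move=> [[x y] z]; have [t /= near_t] := filter_ex (median_near x y z).
  by exists (SigSub (mem_set (fH (cmed (lift (val x) t) (lift (val y) t) (lift (val z) t))))).
pose mu x y z := mu3 (x, y, z).
have muP x y z : mdist (val (mu x y z)) (m (val x) (val y) (val z)) <= C.
  exact: (mu3P (x, y, z)).
have /choice[phi phiP] : forall x : H, exists w : V,
    U [set t | uval w t = lift (val x) t].
  by move=> x; apply: uclass; apply: lift_tame.
have near_phi x : U [set t | mdist (val x) (f (uval (phi x) t)) <= E].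
  by apply: filterS2 (phiP x) (liftP (HP x)) => t /= ->.
exists mu, phi; split.
- by move=> x y z; apply: le_trans (muP x y z) _.
- split=> [x y|w].
    have [t [/= dE [dx dy]]] := filter_ex
      (filterI (ultraproduct_cdist (phi x) (phi y)) (filterI (near_phi x) (near_phi y))).
    rewrite /vdist /sub_dist -dE.
    have up := f_upper (uval (phi x) t) (uval (phi y) t).
    have lo := f_lower (uval (phi x) t) (uval (phi y) t).
    rewrite /vdist in up lo; set D : R := (cdist _ _)%:R in up lo *.
    have D_ge0 : 0 <= D by [].
    have t1 := mdist_triangle (f (uval (phi x) t)) (val x) (val y).
    have t2 := mdist_triangle (f (uval (phi y) t)) (f (uval (phi x) t)) (val y).
    have t3 := mdist_triangle (val x) (f (uval (phi x) t)) (f (uval (phi y) t)).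
    have t4 := mdist_triangle (val y) (val x) (f (uval (phi y) t)).
    rewrite (metric_sym (f (uval (phi y) t)) (val y)) in t2.
    rewrite (metric_sym (f (uval (phi x) t)) (val x)) in t3.
    set d := mdist (val x) (val y) in t1 t4 *; set e := mdist (f _) (f _) in t2 t3 up lo *.
    have d_le : d <= 2 * E + K + K * D by lra.
    have l_gt0 : 0 < l by apply: lt_le_trans l_ge1.
    apply/andP; split.
      rewrite lerBlDr ler_pdivrMl // (le_trans d_le) // mulrDr addrC.
      apply: lerD; first exact: ler_wpM2r.
      by apply: le_trans EKl _; rewrite -[leLHS]mulr1; apply: ler_wpM2l => //; exact: ltW.
    apply: (le_trans lo); have e_le : e <= d + 2 * E by lra.
    apply: le_trans (_ : K * (d + (2 * E + K)) <= _).
      by apply: ler_wpM2l => //; lra.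
    rewrite mulrDr; apply: lerD => //; apply: ler_wpM2r => //; exact: mdist_ge0.
  have [N bnd_w] := uval_tame w.
  have bnd : U [set t | mdist x0 (f (uval w t)) <= E + (K * N%:R + K)].
    apply: filterS2 bnd_w (liftP Hx0) => t /= wN near_x0.
    apply: le_trans (mdist_triangle (f (base t)) _ _) _; apply: lerD => //.
    apply: le_trans (f_upper _ _) _; rewrite lerD2r; apply: ler_wpM2l => //.
    by rewrite ler_nat.
  have [s _ near_s] := bounded_ultra UU bnd (filterT : U setT).
  have /mem_set Hs := fH (uval w s).
  pose x : H := SigSub Hs; exists x.
  have [t [/= dE [dx dw]]] := filter_ex
    (filterI (ultraproduct_cdist (phi x) w) (filterI (near_phi x) near_s)).
  rewrite /vdist -dE; apply: le_trans (f_lower _ _) _.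
  apply: le_trans KE2l.
  apply: ler_wpM2l => //; rewrite lerD2r.
  apply: le_trans (mdist_triangle (val x) _ _) _; rewrite metric_sym.
  exact: lerD.
- move=> x y z.
  have [t [[/= dE cE] [/= dmu [/= dx [dy dz]]]]] := filter_ex (filterI
    (filterI (ultraproduct_cdist (phi (mu x y z)) (cmed (phi x) (phi y) (phi z)))
      (ultraproduct_cmed (phi x) (phi y) (phi z)))
    (filterI (near_phi (mu x y z)) (filterI (near_phi x) (filterI (near_phi y) (near_phi z))))).
  rewrite /vdist -dE; apply: le_trans (f_lower _ _) _.
  apply: le_trans Kl3.
  apply: ler_wpM2l => //; rewrite lerD2r cE.
  apply: le_trans (mdist_triangle (m (f (uval (phi x) t)) (f (uval (phi y) t))
    (f (uval (phi z) t))) _ _) _.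
  apply: lerD; last by rewrite metric_sym; apply: f_median.
  apply: le_trans (mdist_triangle (m (val x) (val y) (val z)) _ _) _.
  apply: lerD; last exact: lip.
  apply: le_trans (mdist_triangle (val (mu x y z)) _ _) _.
  by apply: lerD => //; rewrite metric_sym.
Qed.

End LimitComplex.

(** * Finite samples of the rays *)

Lemma samples_card (T : choiceType) (S : Type) n k (F : set T) (Y : set (S -> T)) (s0 s1 : S) :
  F #= `I_n -> Y #= `I_k -> exists2 n', (n' <= n + (k + k))%N &
    F `|` [set u s0 | u in Y] `|` [set u s1 | u in Y] #= `I_n'.
Proof.
move=> /card_eq_range[gF ->] /card_eq_range[gY ->].
pose g (i : 'I_n + ('I_k + 'I_k)) : T := match i with
  | inl i => gF i | inr (inl j) => gY j s0 | inr (inr j) => gY j s1 end.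
suff -> : range gF `|` [set u s0 | u in range gY] `|` [set u s1 | u in range gY] = range g.
  by have [n' le_n' gn'] := range_card g; exists n'; rewrite // !card_sum !card_ord in le_n'.
apply/seteqP; split=> [x [[[i _ <-]|[_ [j _ <-] <-]]|[_ [j _ <-] <-]]|_ [[i|[j|j]] _ <-]].
- by exists (inl i).
- by exists (inr (inl j)).
- by exists (inr (inr j)).
- by left; left; exists i.
- by left; right; exists (gY j) => //; exists j.
- by right; exists (gY j) => //; exists j.
Qed.

Theorem theorem2 (R : realType) (X : metricType R) (m : X -> X -> X -> X)
    (r : nat) (lambda0 : R)
    (proper_X : proper_space X) (LQC_X : LQC m r) (lambda0_gt0 : 0 < lambda0) :
  exists (D : nat) (lambda : nat -> nat -> R),
    (forall n k, 0 < lambda n k) /\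
    forall (n k : nat) (F : set X) (Y : set ({nonneg R} -> X)),
      F !=set0 -> F #= `I_n -> Y #= `I_k ->
      (forall h, Y h -> median_ray m lambda0 h) ->
      let H := median_hull m r (F `|` \bigcup_(h in Y) range h) in
      exists Q : cube_complex, [/\ CAT0 Q, dim_le Q D &
        exists (mu : H -> H -> H -> H) (f : H -> Q),
          [/\ induced_median m (lambda n k) mu,
              quasi_isometry (@sub_dist R X H) (@vdist R Q) (lambda n k) f &
              median_map mu (@vdist R Q) (@cmed Q) (lambda n k) f]].
Proof.
have [[h [lip_m approx_m]] [v [K [_ K_gt0 lqc]]]] := LQC_X.
have [c c_ge0 exhausted] := hull_exhausted lip_m approx_m lambda0_gt0.
pose L : R := (h 1%N)%:R; have L_ge0 : 0 <= L by [].
(* a bound for the constants of all sets with at most [n + 2 k] elements *)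
pose kap n k : R := \sum_(i < (n + (k + k)).+1) K i.
have K_le n k i : (i <= n + (k + k))%N -> K i <= kap n k.
  move=> le_i; rewrite /kap (bigD1 (inord i)) //= inordK // lerDl.
  by apply: sumr_ge0 => j _; exact: ltW.
have kap_ge0 n k : 0 <= kap n k by apply: sumr_ge0 => j _; exact: ltW.
have E_ge0 n k : 0 <= c + kap n k by apply: addr_ge0.
exists v, (fun n k => limit_constant L (kap n k) (c + kap n k)); split=> [n k|].
  apply: lt_le_trans ltr01 _.
  by have [] := limit_constant_bounds L_ge0 (kap_ge0 n k) (E_ge0 n k).
move=> n k F Y [x1 Fx1] Fn Yk rays H; set kappa := kap n k.
have [x0 Hx0] : H !=set0 by apply: iter_join_nonempty; exists x1; left.
pose A t := truncation F Y t.
have approx_t t : exists (Q : cube_complex) (f : Q -> X), [/\ CAT0 Q, dim_le Q v,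
    forall q, median_hull m r (A t) (f q),
    forall y, median_hull m r (A t) y -> exists q, mdist y (f q) <= kappa &
    [/\ forall p q, mdist (f p) (f q) <= kappa * vdist R p q + kappa,
        forall p q, vdist R p q <= kappa * (mdist (f p) (f q) + kappa) &
        median_map (@cmed Q) (@mdist R X) m kappa f]].
  have [n' le_n' An'] := samples_card 0%:nng t%:R%:nng Fn Yk.
  have A0 : A t !=set0 by exists x1; left; left.
  have [Q [catQ [dimQ _] [f [[f_qi f_dense] f_median]]]] := lqc n' (A t) A0 An'.
  have Kn'_gt0 := K_gt0 n'; have Kn'_le := K_le n k n' le_n'.
  exists Q, (fun q => val (f q)); split=> //.
  - by move=> q; apply: set_valP.
  - move=> y Ay; have [q fq] := f_dense (SigSub (mem_set Ay)); exists q.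
    by rewrite metric_sym; apply: le_trans fq Kn'_le.
  - split.
    + move=> p q; have /andP[_ up] := f_qi p q; apply: le_trans up _.
      by apply: lerD => //; apply: ler_wpM2r.
    + move=> p q; have /andP[lo _] := f_qi p q.
      move: lo; rewrite lerBlDr ler_pdivrMl // => lo; apply: le_trans lo _.
      apply: ler_pM; [exact: ltW | by rewrite addr_ge0 ?mdist_ge0 // ltW | exact: Kn'_le |].
      by rewrite lerD2l.
    + by move=> x y z; apply: le_trans (f_median x y z) Kn'_le.
have /choice[Q QP] := approx_t.
pose f t := projT1 (cid (QP t)).
pose fP t := projT2 (cid (QP t)).
have A_hull t y : median_hull m r (A t) y -> H y.
  apply: iter_join_subset => z [[Fz|[u Yu <-]]|[u Yu <-]]; first by left.
    by right; exists u => //; exists 0%:nng.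
  by right; exists u => //; exists t%:R%:nng.
have inhab t : exists q : Q t, True.
  have [_ _ _ f_dense _] := fP t.
  have [|y Ay] := @iter_join_nonempty _ m r (A t); first by exists x1; left; left.
  by have [q _] := f_dense y Ay; exists q.
pose base t := projT1 (cid (inhab t)).
have [U [UU inf_U]] := ultraFilterLemma eventually_filter.
have dense x : H x -> U [set t | exists q : Q t, mdist x (f t q) <= c + kappa].
  move=> Hx; have [T near_x] := exhausted F Y rays x Hx.
  apply: filterS (inf_U _ (nbhs_infty_ge T)) => t /near_x[y Ay xy].
  have [_ _ _ /(_ y Ay)[q yq] _] := fP t.
  by exists q; apply: le_trans (mdist_triangle y _ _) _; apply: lerD.
apply: (@exists_limit_complex R X m L proper_X L_ge0 lip_m H x0 Q v f kappa (c + kappa) base U) => //.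
- exact: kap_ge0.
- exact: E_ge0.
- by move=> t; have [] := fP t.
- by move=> t; have [] := fP t.
- by move=> t q; have [_ _ fA _ _] := fP t; apply: A_hull (fA q).
- by move=> t; have [_ _ _ _ []] := fP t.
- by move=> t; have [_ _ _ _ []] := fP t.
- by move=> t; have [_ _ _ _ []] := fP t.
Qed.
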